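(* Let $\square\subseteq\mathbb R^2$ be the unit square (side length $1$). Then every rectifiable barrier $B$ of $\square$ satisfies $\lvert B\rvert \ge 2.00002$.
   Context: A barrier (opaque set) for $U\subseteq\mathbb R^2$ is a set $B\subseteq\mathbb R^2$ that intersects every straight line that intersects $U$. $B$ is rectifiable if it is a union of countably many curves, pairwise disjoint except possibly at their endpoints, each of finite length, such that the sum of their lengths converges; this sum is the length $\lvert B\rvert$ of $B$. Barriers need not be connected and need not lie inside $U$. *)

(* Defs.v *)
From HB Require Import structures.
From mathcomp Require Import all_boot all_order all_algebra.
From mathcomp Require Import all_classical all_reals all_analysis.
Set Implicit Arguments. Unset Strict Implicit. Unset Printing Implicit Defensive.
Import Order.TTheory GRing.Theory Num.Theory.
Import numFieldNormedType.Exports.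
Local Open Scope classical_set_scope.
Local Open Scope ring_scope.

Section Barrier.
Variable R : realType.

Definition pt := (R * R)%type.

Definition edist (p q : pt) : R :=
  Num.sqrt ((p.1 - q.1) ^+ 2 + (p.2 - q.2) ^+ 2).

Definition line (p v : pt) : set pt :=
  [set q | exists t : R, q = (p.1 + t * v.1, p.2 + t * v.2)].

Definition barrier (U B : set pt) : Prop :=
  forall p v : pt, v != (0, 0) ->
    line p v `&` U !=set0 -> line p v `&` B !=set0.

Definition unit_square : set pt :=
  [set q | 0 <= q.1 <= 1 /\ 0 <= q.2 <= 1].

Definition curve_length (g : R -> pt) : \bar R :=
  ereal_sup [set x : \bar R | exists (n : nat) (s : nat -> R),
     [/\ s 0%N = 0, s n = 1, (forall i, (i < n)%N -> s i <= s i.+1)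
        & x = (\sum_(i < n) edist (g (s i)) (g (s i.+1)))%:E]].

Definition is_curve (g : R -> pt) : Prop :=
  {within `[0, 1]%classic, continuous g}.

Definition endpoints (g : R -> pt) : set pt := [set g 0; g 1].

Definition rectifiable_decomposition (B : set pt) (S : set nat)
    (g : nat -> R -> pt) (L : \bar R) : Prop :=
  (forall i, S i -> is_curve (g i)) /\
  (forall i, S i -> (curve_length (g i) < +oo)%E) /\
  (forall i j, S i -> S j -> i <> j ->
     (g i @` `[0, 1]%classic) `&` (g j @` `[0, 1]%classic)
       `<=` endpoints (g i) `|` endpoints (g j)) /\
  (B = \bigcup_(i in S) (g i @` `[0, 1]%classic)) /\
  (L = \sum_(i <oo | i \in S) curve_length (g i))%E /\
  (L < +oo)%E.

Definition rectifiable_with_length (B : set pt) (L : \bar R) : Prop :=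
  exists (S : set nat) (g : nat -> R -> pt), rectifiable_decomposition B S g L.

End Barrier.

(* Main.v *)
Require Import Defs.
From HB Require Import structures.
From mathcomp Require Import all_boot all_order all_algebra.
From mathcomp Require Import all_classical all_reals all_analysis.
From mathcomp Require Import ring lra.
Import Order.TTheory GRing.Theory Num.Theory.
Local Open Scope classical_set_scope.
Local Open Scope ring_scope.

(** Projected to a line in the direction [u], the pieces of a barrier cover the
    projection of the square. Averaging over directions [u] chosen so that the
    average of [|u . v|] is at most the length of [v], with equality on the axes,
    gives [|B| >= 2]; the excess over 2 bounds the average overlap of the
    projections, and also the length of the pieces that are not almost parallel
    to a side or lie far from the square. If the excess is tiny, a pigeonhole
    argument finds many almost horizontal pieces [P] and almost vertical pieces
    [Q] such that every piece of [P] is separated from every piece of [Q] both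
    horizontally and vertically. While [u] turns through [(1 + s, 1 - s)], the
    projection of each piece of [Q] overtakes that of each piece of [P]. Pieces
    of one family may coincide at such a moment, so the overlaps of the pairs do
    not simply add up. To repair this, sort the projected positions of each
    family and push them to the right until they are disjoint: the union of the
    intervals only grows, the speeds remain in the same range, and now the
    overlaps of all pairs do add up to an excess above 1/50000. *)

(** * Lebesgue measure of unions of intervals *)

Section Measure.
Context {R : realType}.
Implicit Types (a b e : R) (E F : set R).

Definition meas_le e E : Prop :=
  measurable E /\ (lebesgue_measure E <= e%:E)%E.

Lemma meas_le_ge0 e E : meas_le e E -> 0 <= e.
Proof. by case=> mE; rewrite -lee_fin; apply: le_trans; apply: measure_ge0. Qed.

Lemma meas_le0 : meas_le 0 set0.
Proof. by split; rewrite ?measure0. Qed.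

Lemma meas_le_cc a b : a <= b -> meas_le (b - a) `[a, b]%classic.
Proof.
move=> ab; split; first exact: measurable_itv.
by rewrite lebesgue_measure_itv /= lte_fin; case: ifP => _; rewrite lee_fin // subr_ge0.
Qed.

Lemma meas_leU e E e' E' : meas_le e E -> meas_le e' E' -> meas_le (e + e') (E `|` E').
Proof.
move=> [mE lE] [mE' lE']; split; first exact: measurableU.
by have h := measureU2 (@lebesgue_measure R) mE mE'; apply: le_trans h _; rewrite EFinD leeD.
Qed.

Lemma meas_leW e e' E : meas_le e E -> e <= e' -> meas_le e' E.
Proof. by move=> [mE lE] ee'; split=> //; apply: le_trans lE _; rewrite lee_fin. Qed.

Lemma meas_le_seq (T : eqType) (s : seq T) (e : T -> R) (E : T -> set R) :
  (forall x, x \in s -> meas_le (e x) (E x)) ->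
  exists F, meas_le (\sum_(x <- s) e x) F /\ forall x, x \in s -> E x `<=` F.
Proof.
elim: s => [|x s IH] h.
  by exists set0; rewrite big_nil; split=> //; exact: meas_le0.
have [y ys|F [mF hF]] := IH; first by apply: h; rewrite inE ys orbT.
exists (E x `|` F); rewrite big_cons; split.
  by apply: meas_leU => //; apply: h; rewrite inE eqxx.
move=> y; rewrite inE => /orP[/eqP -> t Et|/hF EF t /EF Ft]; [by left|by right].
Qed.

Lemma meas_le_itv_sub a b e E : meas_le e E -> `[a, b]%classic `<=` E -> b - a <= e.
Proof.
move=> [mE lE] sub; have [ba|ab] := leP b a.
  by apply: le_trans (meas_le_ge0 _ _ (conj mE lE)); rewrite subr_le0.
have : (lebesgue_measure (`[a, b]%classic : set R) <= lebesgue_measure E)%E.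
  by apply: le_measure => //; rewrite inE //; exact: measurable_itv.
rewrite lebesgue_measure_itv /= lte_fin ab => h.
by rewrite -lee_fin EFinB; apply: le_trans h lE.
Qed.

Lemma meas_le_bigcup (E : nat -> set R) (l : nat -> \bar R) e :
  (forall i, measurable (E i)) -> (forall i, (lebesgue_measure (E i) <= l i)%E) ->
  (\sum_(i <oo) l i <= e%:E)%E -> meas_le e (\bigcup_i E i).
Proof.
move=> mE lE le; split; first exact: bigcup_measurable.
have h := measure_sigma_subadditive (@lebesgue_measure R) mE
  (bigcup_measurable (fun k _ => mE k)) (@subset_refl _ _).
apply: le_trans h _.
by apply: le_trans le; apply: lee_nneseries => [i _ _|i _]; [exact: measure_ge0|exact: lE].
Qed.

(** Half-open, so that intervals whose centres are exactly [w] apart are disjoint. *)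
Definition half_open (c w : R) : set R := `[c - w / 2, c + w / 2[%classic.

Lemma half_open_measure (c w : R) : 0 <= w ->
  lebesgue_measure (half_open c w) = w%:E.
Proof.
move=> w0; rewrite lebesgue_measure_itv /= lte_fin.
case: ifP => [_|/negbT]; first by rewrite -EFinB; congr EFin; lra.
by rewrite -leNgt => h; congr EFin; lra.
Qed.

Lemma lebesgue_bigsetU n (F : 'I_n -> set R) :
  (forall i, measurable (F i)) -> trivIset setT F ->
  lebesgue_measure (\big[setU/set0]_(i < n) F i) = (\sum_(i < n) lebesgue_measure (F i))%E.
Proof.
move=> mF tF.
have mU : measurable (\big[setU/set0]_(i < n) F i) by apply: bigsetU_measurable.
exact: (measure_semi_additive_ord (@lebesgue_measure R) mF tF mU).
Qed.

Lemma half_open_disjoint n (c : nat -> R) (w : R) :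
  (forall i j, (i < j < n)%N -> c i + w <= c j) ->
  trivIset setT (fun i : 'I_n => half_open (c i) w).
Proof.
move=> sep; apply/trivIsetP => i j _ _ ij; apply/seteqP; split => // t [].
rewrite /half_open /= !in_itv /= => /andP[h1 h2] /andP[h3 h4].
wlog lij : i j ij h1 h2 h3 h4 / (i < j)%N => [hw|].
  have := ij; rewrite neq_ltn => /orP[lij|lji]; first exact: (hw i j).
  by apply: (hw j i) => //; rewrite eq_sym.
by have := sep i j; rewrite lij ltn_ord => /(_ isT); lra.
Qed.

(** The interval of length [r] that starts at the larger of the two left ends lies in both. *)
Lemma half_open_overlap (p q w w' r : R) : 0 <= r ->
  r <= w -> r <= w' -> `|q - p| <= (w + w') / 2 - r ->
  (r%:E <= lebesgue_measure (half_open p w `&` half_open q w'))%E.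
Proof.
move=> r0 rw rw' /ler_normlP[h1 h2].
pose a := Num.max (p - w / 2) (q - w' / 2).
have sub : `[a, a + r[%classic `<=` half_open p w `&` half_open q w'.
  move=> t; rewrite /half_open /= !in_itv /= => /andP[]; rewrite /a ge_max => /andP[-> ->] /=.
  by case: (leP (p - w / 2) (q - w' / 2)) => h ht; split; lra.
apply: (@le_trans _ _ (lebesgue_measure (`[a, a + r[%classic : set R))).
  rewrite lebesgue_measure_itv /= lte_fin.
  case: ifP => [_|/negbT]; first by rewrite -EFinB lee_fin; lra.
  by rewrite -leNgt lee_fin => h; lra.
by apply: le_measure => //; rewrite inE; [|apply: measurableI]; exact: measurable_itv.
Qed.

(** Inclusion and exclusion. Each family is disjoint, so the intersections of the single pairs are
    disjoint too, and their measures add up inside the intersection of the two unions. *)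
Lemma meas_le_two_families n m (p q : nat -> R) (w w' r : R) :
  0 <= r -> r <= w -> r <= w' ->
  (forall i j, (i < j < n)%N -> p i + w <= p j) ->
  (forall i j, (i < j < m)%N -> q i + w' <= q j) ->
  meas_le (n%:R * w + m%:R * w' -
     r * (\sum_(i < n) \sum_(j < m) (`|q j - p i| <= (w + w') / 2 - r)%R%:R))
   (\big[setU/set0]_(i < n) half_open (p i) w `|` \big[setU/set0]_(j < m) half_open (q j) w').
Proof.
move=> r0 rw rw' sp sq.
have w0 : 0 <= w by lra.
have w0' : 0 <= w' by lra.
set A := \big[setU/set0]_(i < n) _; set B := \big[setU/set0]_(j < m) _.
have mp i : measurable (half_open (p i) w) by exact: measurable_itv.
have mq i : measurable (half_open (q i) w') by exact: measurable_itv.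
have mA : measurable A by apply: bigsetU_measurable.
have mB : measurable B by apply: bigsetU_measurable.
have tA := half_open_disjoint _ _ _ sp.
have tB := half_open_disjoint _ _ _ sq.
have muA : lebesgue_measure A = (n%:R * w)%:E.
  rewrite (lebesgue_bigsetU _ _ (fun k => mp k) tA).
  rewrite (eq_bigr (fun=> w%:E)); last by move=> i _; exact: half_open_measure.
  by rewrite sumEFin sumr_const card_ord mulr_natl.
have muB : lebesgue_measure B = (m%:R * w')%:E.
  rewrite (lebesgue_bigsetU _ _ (fun k => mq k) tB).
  rewrite (eq_bigr (fun=> w'%:E)); last by move=> i _; exact: half_open_measure.
  by rewrite sumEFin sumr_const card_ord mulr_natl.
rewrite /meas_le; split; first exact: measurableU.
have eqle (x y : \bar R) : x = y -> (x <= y)%E by move=> ->.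
have ltA : (lebesgue_measure A < +oo)%E by rewrite muA ltry.
have hU : (lebesgue_measure (A `|` B) <=
    lebesgue_measure A + lebesgue_measure B - lebesgue_measure (A `&` B))%E.
  exact: eqle _ _ (@measureUfinl _ _ _ (@lebesgue_measure R) _ _ mA mB ltA).
apply: le_trans hU _.
rewrite muA muB EFinB EFinD; apply: leeB => //.
have mAB i : measurable (half_open (p i) w `&` B) by exact: measurableI.
have tAB : trivIset setT (fun i : 'I_n => half_open (p i) w `&` B) by exact: trivIset_setIr.
have muAB := lebesgue_bigsetU _ _ (fun i => mAB i) tAB.
have hA := eqle _ _ (esym muAB).
rewrite /A big_distrl /=; apply: le_trans hA.
rewrite mulr_sumr -sumEFin; apply: lee_sum => i _.
have mI j : measurable (half_open (p i) w `&` half_open (q j) w') by exact: measurableI.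
have tI : trivIset setT (fun j : 'I_m => half_open (p i) w `&` half_open (q j) w').
  exact: trivIset_setIl.
have muI := lebesgue_bigsetU _ _ (fun j => mI j) tI.
have hI := eqle _ _ (esym muI).
rewrite mulr_sumr -sumEFin /B [X in lebesgue_measure X]big_distrr /=.
apply: le_trans hI; apply: lee_sum => j _.
case: (boolP (`|q j - p i| <= _)) => [h|_]; rewrite ?mulr1 ?mulr0 ?measure_ge0 //.
exact: half_open_overlap.
Qed.
End Measure.

(** * Order statistics and pushing *)

Section OrderStatistics.
Context {R : realType}.
Implicit Types (s : seq R) (z : nat -> R).

Definition ostat s (i : nat) : R := nth 0 (sort <=%R s) i.

Lemma sorted_nth_le s i (t : R) : sorted <=%R s -> (i < size s)%N ->
  (nth 0 s i <= t) = (i < count (fun x => (x <= t)%R) s)%N.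
Proof.
elim: s i => [//|x s IH] i /= srt; case: i => [_|i] /=.
  case: (leP x t) => //= xt; rewrite add0n; apply/esym/negbTE; rewrite -leqNgt leqn0.
  apply/negP => /negP; rewrite -lt0n -has_count => /hasP[y ys yt].
  have := order_path_min le_trans srt => /allP/(_ _ ys); lra.
rewrite ltnS => lt; rewrite (IH _ (path_sorted srt) lt).
case: (leP x t) => xt; first by rewrite add1n ltnS.
rewrite add0n; have -> : count (fun x => (x <= t)%R) s = 0%N.
  apply/eqP; rewrite -leqn0 leqNgt -has_count; apply/negP => /hasP[y ys yt].
  have := order_path_min le_trans srt => /allP/(_ _ ys); lra.
by rewrite !ltn0.
Qed.

(** Sorted positions are compared through counting, which does not depend on the order of the
    sequence. *)
Lemma ostat_le s i (t : R) : (i < size s)%N ->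
  (ostat s i <= t) = (i < count (fun x => (x <= t)%R) s)%N.
Proof.
move=> lt; rewrite /ostat sorted_nth_le ?size_sort //; last exact: sort_le_sorted.
by rewrite count_sort.
Qed.

Lemma ostat_homo s i j : (i <= j < size s)%N -> ostat s i <= ostat s j.
Proof.
move=> /andP[ij lt]; apply: (sorted_leq_nth le_trans lexx) => //.
- exact: sort_le_sorted.
- by rewrite inE size_sort (leq_ltn_trans ij).
- by rewrite inE size_sort.
Qed.

Lemma ostat_mem s i : (i < size s)%N -> ostat s i \in s.
Proof. by move=> lt; rewrite -(mem_sort <=%R) mem_nth ?size_sort. Qed.

Lemma mem_ostat s x : x \in s -> exists2 i, (i < size s)%N & ostat s i = x.
Proof.
rewrite -(mem_sort <=%R) => xs; exists (index x (sort <=%R s)).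
  by rewrite -(size_sort <=%R) index_mem.
exact: nth_index.
Qed.

(** Every entry with [g p] below the threshold has [f p] below the threshold plus [a], so the count
    cannot drop, even though [f] and [g] may sort [P] differently. *)
Lemma ostat_shift (T : eqType) (P : seq T) (f g : T -> R) a i : (i < size P)%N ->
  {in P, forall p, f p <= g p + a} ->
  ostat [seq f p | p <- P] i <= ostat [seq g p | p <- P] i + a.
Proof.
move=> lt fg; rewrite ostat_le ?size_map // count_map.
have : (i < count (fun x => (x <= ostat [seq g p | p <- P] i)%R) [seq g p | p <- P])%N.
  by rewrite -ostat_le ?size_map.
rewrite count_map => /leq_trans; apply.
apply: (@leq_trans (count (predI (preim g (fun x => (x <= ostat [seq g p | p <- P] i)%R))
    (mem P)) P)).
  by apply: eq_leq; apply: eq_in_count => p pP /=; rewrite pP andbT.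
by apply: sub_count => p /= /andP[gp pP]; have := fg p pP; lra.
Qed.

(* Centres of the intervals of width [w] after pushing to the right. *)
Fixpoint push z (w : R) (i : nat) : R :=
  if i is j.+1 then Num.max (z i) (push z w j + w) else z 0%N.

Lemma push_ge z w i : z i <= push z w i.
Proof. by case: i => [|i] //=; rewrite le_max lexx. Qed.

Lemma push_sep z w i j : 0 <= w -> (i < j)%N -> push z w i + w <= push z w j.
Proof.
move=> w0; elim: j => [//|j IH]; rewrite ltnS leq_eqVlt => /orP[/eqP <-|lt].
  by rewrite /= le_max lexx orbT.
apply: le_trans (IH lt) _; rewrite /= le_max; apply/orP; right; lra.
Qed.

Lemma push_ub z w M i : 0 <= w -> (forall j, (j <= i)%N -> z j <= M) ->
  push z w i <= M + i%:R * w.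
Proof.
move=> w0; elim: i => [|i IH] h /=; first by rewrite mul0r addr0 h.
rewrite ge_max; apply/andP; split.
  by apply: le_trans (h _ (leqnn _)) _; rewrite lerDl mulr_ge0.
have := IH (fun j ji => h j (leqW ji)); rewrite -natr1; lra.
Qed.

(** Pushing is monotone, commutes with translations and moves the centres less when the width
    shrinks. *)
Lemma push_shift z z' w w' a i : w' <= w -> (forall j, (j <= i)%N -> z' j <= z j + a) ->
  push z' w' i <= push z w i + a.
Proof.
move=> ww; elim: i => [|i IH] h /=; first exact: h.
have h1 := h _ (leqnn _); have h2 := IH (fun j ji => h j (leqW ji)).
by rewrite ge_max; apply/andP; split; rewrite -lerBlDr le_max; apply/orP; [left|right]; lra.
Qed.

(** Pushing uncovers no point. If [t] lies to the left of the pushed interval [i], this interval was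
    moved until it touched its predecessor, so [t] lies to the left of the right end of the
    predecessor and the descent continues. *)
Lemma push_cover z w i t : (forall j k, (j <= k <= i)%N -> z j <= z k) ->
  half_open (z i) w t -> exists2 k, (k <= i)%N & half_open (push z w k) w t.
Proof.
move=> hz ht.
(* The invariant of the descent: [t] is between the left end of the original interval and the right
   end of the pushed one. *)
have {ht} : z i - w / 2 <= t < push z w i + w / 2.
  move: ht; rewrite /half_open /= in_itv /= => /andP[-> h] /=.
  by have := push_ge z w i; lra.
elim: i hz => [|i IH] hz /andP[h1 h2].
  by exists 0%N => //; rewrite /half_open /= in_itv /= h1 h2.
have [le|lt] := leP (push z w i.+1 - w / 2) t.
  by exists i.+1 => //; rewrite /half_open /= in_itv /= le h2.
have [||k ki hk] := IH.
- by move=> j k /andP[jk ki]; apply: hz; rewrite jk leqW.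
- have := hz i i.+1; rewrite leqnSn leqnn => /(_ isT) hzi; apply/andP; split; first lra.
  by move: lt; rewrite /=; case: (leP (z i.+1) (push z w i + w)) => _ ?; lra.
- by exists k => //; rewrite leqW.
Qed.

(** Clamp [D] to absolute value at most [a - eta]. A step raises the clamped value by at most [eta],
    and not at all if [|D k| > a]: then it starts at the top or too low to leave the bottom. The
    total rise is [2 * (a - eta)]. *)
Lemma crossing_count (D : nat -> R) K a eta : 0 <= eta <= a ->
  (forall k, (k < K)%N -> D k.+1 <= D k + eta) -> D 0%N <= - a -> a <= D K ->
  2 * (a - eta) <= eta * \sum_(k < K) (`|D k| <= a)%R%:R.
Proof.
move=> /andP[eta0 etaa] hD D0 DK.
pose c x := if x <= - (a - eta) then - (a - eta) else if a - eta <= x then a - eta else x.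
have step k : (k < K)%N -> c (D k.+1) - c (D k) <= eta * (`|D k| <= a)%R%:R.
  move=> kK; have := hD k kK; rewrite /c => h.
  case: (leP (D k) (- (a - eta))); case: (leP (a - eta) (D k));
  case: (leP (D k.+1) (- (a - eta))); case: (leP (a - eta) (D k.+1)) => h1 h2 h3 h4;
  case: (boolP (`|D k| <= a)) => [|]; rewrite ?mulr1 ?mulr0 ?ler_norml ?negb_and -?ltNge;
  by [move=> /andP[]; lra | move=> /orP[]; lra].
have : \sum_(k < K) (c (D k.+1) - c (D k)) = c (D K) - c (D 0%N).
  by rewrite -(big_mkord xpredT (fun k => c (D k.+1) - c (D k))) telescope_sumr.
have -> : c (D K) = a - eta.
  by rewrite /c; case: ifPn => ?; first lra; case: ifPn; rewrite -?ltNge; lra.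
have -> : c (D 0%N) = - (a - eta).
  by rewrite /c; case: ifPn => ?; first lra; case: ifPn; rewrite -?ltNge; lra.
have hs : \sum_(k < K) (c (D k.+1) - c (D k)) <= eta * \sum_(k < K) (`|D k| <= a)%R%:R.
  by rewrite mulr_sumr; apply: ler_sum => k _; apply: step.
by move=> tel; move: hs; rewrite tel; lra.
Qed.

End OrderStatistics.

(** * Two families of projections crossing each other *)

Section Crossing.
Context {R : realType}.
Implicit Types (P Q : seq (R * R)) (p q : R * R).

(** The projection to the direction with parameter [s]; a piece moves at the speed [p.1 - p.2] as
    [s] grows. *)
Definition tilt (s : R) p : R := (1 + s) * p.1 + (1 - s) * p.2.

Lemma push_family_cover P (s w : R) p : p \in P ->
  half_open (tilt s p) w `<=`
  \big[setU/set0]_(i < size P) half_open (push (ostat [seq tilt s p | p <- P]) w i) w.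
Proof.
move=> pP t ht.
have [|i lt iE] := @mem_ostat R [seq tilt s p | p <- P] (tilt s p).
  by apply/mapP; exists p.
rewrite size_map in lt; rewrite -iE in ht.
have [|k ki hk] := push_cover _ _ _ _ _ ht.
  by move=> j k /andP[jk ki]; apply: ostat_homo; rewrite jk size_map (leq_ltn_trans ki).
rewrite -(bigcup_mkord _ (fun i => half_open (push (ostat [seq tilt s p | p <- P]) w i) w)).
by exists k => //=; apply: leq_ltn_trans lt.
Qed.

Lemma ostat_tilt_bounds P (s x0 x1 y0 y1 : R) i : -1 <= s <= 1 ->
  {in P, forall p, x0 <= p.1 <= x1 /\ y0 <= p.2 <= y1} -> (i < size P)%N ->
  (1 + s) * x0 + (1 - s) * y0 <= ostat [seq tilt s p | p <- P] i <=
  (1 + s) * x1 + (1 - s) * y1.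
Proof.
move=> /andP[s0 s1] box lt.
have /mapP[p pP ->] : ostat [seq tilt s p | p <- P] i \in [seq tilt s p | p <- P].
  by apply: ostat_mem; rewrite size_map.
have [/andP[a1 a2] /andP[b1 b2]] := box p pP.
by rewrite /tilt; apply/andP; split; apply: lerD; apply: ler_wpM2l => //; lra.
Qed.

(** The width must not grow, so the family with widths [om * (1 - s)] is followed forwards and the
    one with widths [om * (1 + s)] backwards, with a negative [h]. *)
Lemma push_tilt_shift P (s h w w' a : R) i : w' <= w -> (i < size P)%N ->
  {in P, forall p, h * (p.1 - p.2) <= a} ->
  push (ostat [seq tilt (s + h) p | p <- P]) w' i <=
  push (ostat [seq tilt s p | p <- P]) w i + a.
Proof.
move=> ww lt box; apply: push_shift => // j ji; apply: ostat_shift.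
  exact: leq_ltn_trans lt.
by move=> p pP; have := box p pP; rewrite /tilt; lra.
Qed.

(* [N k] counts the pairs overlapping by at least [om / 5] in the [k]-th direction;
   the two widths have the sum [2 om], so this happens as soon as the centres are
   within [4/5 om]. *)
Lemma crossing P Q (om h s0 : R) (K : nat) (xp0 xp1 yp0 yp1 xq0 xq1 yq0 yq1 : R) :
  0 < om <= 1 / 1000 -> 0 <= h ->
  {in P, forall p, xp0 <= p.1 <= xp1 /\ yp0 <= p.2 <= yp1} ->
  {in Q, forall q, xq0 <= q.1 <= xq1 /\ yq0 <= q.2 <= yq1} ->
  174 / 1000 <= xq0 - xp1 -> xq1 - xp0 <= 131 / 100 ->
  249 / 1000 <= yp0 - yq1 -> yp1 - yq0 <= 131 / 100 ->
  (size P)%:R * om <= 22 / 1000 -> (size Q)%:R * om <= 625 / 10000 ->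
  -4 / 5 <= s0 <= -79 / 100 -> 4 / 5 <= s0 + K%:R * h <= 81 / 100 ->
  (forall k, (k < K)%N -> s0 + k%:R * h <= 4 / 5) ->
  262 / 100 * h <= 4 / 5 * om ->
  exists N : nat -> R,
    (size P)%:R * (size Q)%:R * (2 * (4 / 5 * om - 262 / 100 * h)) <=
      262 / 100 * h * \sum_(k < K) N k /\
    forall k, (k < K)%N -> let s := s0 + k%:R * h in
    exists F, meas_le ((size P)%:R * (om * (1 + s)) + (size Q)%:R * (om * (1 - s)) - om / 5 * N k) F /\
     {in P, forall p, half_open (tilt s p) (om * (1 + s)) `<=` F} /\
     {in Q, forall q, half_open (tilt s q) (om * (1 - s)) `<=` F}.
Proof.
move=> /andP[om0 om1] h0 boxP boxQ gx dx gy dy nP nQ /andP[s0l s0u] /andP[sKl sKu] sk hom.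
have kE k : s0 + k.+1%:R * h = (s0 + k%:R * h) + h by rewrite -natr1; clear; lra.
have sge k : s0 <= s0 + k%:R * h by rewrite lerDl mulr_ge0.
pose pz k i := push (ostat [seq tilt (s0 + k%:R * h) p | p <- P]) (om * (1 + (s0 + k%:R * h))) i.
pose qz k i := push (ostat [seq tilt (s0 + k%:R * h) q | q <- Q]) (om * (1 - (s0 + k%:R * h))) i.
have eta0 : 0 <= 262 / 100 * h by apply: mulr_ge0 => //; clear; lra.
exists (fun k => \sum_(i < size P) \sum_(j < size Q) (`|qz k j - pz k i| <= 4 / 5 * om)%R%:R); split.
  (* [Q] lies to the right of [P] and below it, so it is behind [P] in the first, steep direction
     and ahead of it in the last, flat one. *)
  have pair (i : 'I_(size P)) (j : 'I_(size Q)) : 2 * (4 / 5 * om - 262 / 100 * h) <=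
      262 / 100 * h * \sum_(k < K) (`|qz k j - pz k i| <= 4 / 5 * om)%R%:R.
    apply: (crossing_count (fun k => qz k j - pz k i)).
    - by rewrite eta0 hom.
    - move=> k kK; have sgk := sge k; have sk' := sk k kK.
      have hq : qz k.+1 j <= qz k j + h * (xq1 - yq0).
        rewrite /qz kE; apply: push_tilt_shift; last 1 first.
        + move=> q /boxQ[/andP[_ b1] /andP[b2 _]]; apply: ler_wpM2l => //.
          by move: b1 b2; clear; lra.
        + by apply: ler_wpM2l; [exact: ltW|move: h0; clear; lra].
        + exact: ltn_ord.
      have hp : pz k i <= pz k.+1 i + (- h) * (xp0 - yp1).
        rewrite /pz kE; set s := s0 + k%:R * h.
        (* The step of [P] is read backwards, from [s + h] to [s]. *)
        have {1}-> : s = (s + h) + - h by rewrite addrK.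
        apply: push_tilt_shift; last 1 first.
        + move=> q /boxP[/andP[b1 _] /andP[_ b2]]; rewrite !mulNr lerN2; apply: ler_wpM2l => //.
          by move: b1 b2; clear; lra.
        + by apply: ler_wpM2l; [exact: ltW|move: h0; clear; lra].
        + exact: ltn_ord.
      (* The relative speed is at most the sum of the horizontal and the vertical extent of the
         configuration. *)
      have : h * ((xq1 - yq0) - (xp0 - yp1)) <= h * (262 / 100).
        by apply: ler_wpM2l => //; move: dx dy; clear; lra.
      by move: hq hp; clear; lra.
    - have jn : (j : nat)%:R * om <= (size Q)%:R * om.
        by rewrite ler_pM2r // ler_nat ltnW.
      have sb : -1 <= s0 <= 1 by move: s0l s0u; clear; lra.
      have s0' : 0 <= 1 - s0 by move: s0u; clear; lra.
      have hq : qz 0%N j <= (1 + s0) * xq1 + (1 - s0) * yq1 + (j : nat)%:R * (om * (1 - s0)).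
        rewrite /qz mul0r addr0; apply: push_ub; first by apply: mulr_ge0 => //; exact: ltW.
        move=> k kj.
        by have /andP[] := ostat_tilt_bounds Q _ _ _ _ _ _ sb boxQ (leq_ltn_trans kj (ltn_ord j)).
      have hp : (1 + s0) * xp0 + (1 - s0) * yp0 <= pz 0%N i.
        rewrite /pz mul0r addr0; apply: le_trans (push_ge _ _ _).
        by have /andP[] := ostat_tilt_bounds P _ _ _ _ _ _ sb boxP (ltn_ord i).
      have h1 : (1 + s0) * (xq1 - xp0) <= (1 + s0) * (131 / 100).
        by apply: ler_wpM2l => //; move: s0l; clear; lra.
      have h2 : (1 - s0) * (249 / 1000) <= (1 - s0) * (yp0 - yq1) by apply: ler_wpM2l.
      (* Pushing advances [Q] by at most this much, which the vertical gap outweighs; at the other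
         end, the horizontal gap outweighs the pushing of [P]. *)
      have h3 : (1 - s0) * ((j : nat)%:R * om) <= (1 - s0) * (625 / 10000).
        by apply: ler_wpM2l => //; apply: le_trans nQ.
      by move: h1 h2 h3 hq hp s0l s0u om1; clear; lra.
    - have iN : (i : nat)%:R * om <= (size P)%:R * om.
        by rewrite ler_pM2r // ler_nat ltnW.
      have [s sE] : {s | s = s0 + K%:R * h} by exists (s0 + K%:R * h).
      have sl : 4 / 5 <= s by rewrite sE.
      have su : s <= 81 / 100 by rewrite sE.
      have sb : -1 <= s <= 1 by move: sl su; clear; lra.
      have s1 : 0 <= 1 + s by move: sl; clear; lra.
      have s1' : 0 <= 1 - s by move: su; clear; lra.
      have hp : pz K i <= (1 + s) * xp1 + (1 - s) * yp1 + (i : nat)%:R * (om * (1 + s)).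
        rewrite /pz -sE; apply: push_ub; first by apply: mulr_ge0 => //; exact: ltW.
        move=> k kj.
        by have /andP[] := ostat_tilt_bounds P _ _ _ _ _ _ sb boxP (leq_ltn_trans kj (ltn_ord i)).
      have hq : (1 + s) * xq0 + (1 - s) * yq0 <= qz K j.
        rewrite /qz -sE; apply: le_trans (push_ge _ _ _).
        by have /andP[] := ostat_tilt_bounds Q _ _ _ _ _ _ sb boxQ (ltn_ord j).
      have h1 : (1 - s) * (yp1 - yq0) <= (1 - s) * (131 / 100) by apply: ler_wpM2l.
      have h2 : (1 + s) * (174 / 1000 - 22 / 1000) <= (1 + s) * (xq0 - xp1 - (i : nat)%:R * om).
        by apply: ler_wpM2l => //; move: gx iN nP; clear; lra.
      by move: h1 h2 hp hq sl su om1; clear; lra.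
  rewrite exchange_big /= mulr_sumr.
  have -> : (size P)%:R * (size Q)%:R * (2 * (4 / 5 * om - 262 / 100 * h)) =
      \sum_(i < size P) (size Q)%:R * (2 * (4 / 5 * om - 262 / 100 * h)).
    by rewrite sumr_const card_ord -[RHS]mulr_natl [RHS]mulrA.
  apply: ler_sum => i _; rewrite exchange_big /= mulr_sumr.
  have -> : (size Q)%:R * (2 * (4 / 5 * om - 262 / 100 * h)) =
      \sum_(j < size Q) (2 * (4 / 5 * om - 262 / 100 * h)).
    by rewrite sumr_const card_ord -[RHS]mulr_natl.
  by apply: ler_sum => j _; apply: pair.
move=> k kK s; have sk' := sk k kK; have sgk := sge k; rewrite -/s in sk' sgk.
have w0 : om * (1 / 5) <= om * (1 + s).
  by apply: ler_wpM2l; [exact: ltW|move: sgk s0l; clear; lra].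
have w0' : om * (1 / 5) <= om * (1 - s).
  by apply: ler_wpM2l; [exact: ltW|move: sk'; clear; lra].
exists (\big[setU/set0]_(i < size P) half_open (pz k i) (om * (1 + s)) `|`
        \big[setU/set0]_(i < size Q) half_open (qz k i) (om * (1 - s))); split; last first.
  by split=> [p pP t ht|q qQ t ht]; [left|right]; exact: (push_family_cover _ _ _ _ _ _ ht).
have -> : 4 / 5 * om = (om * (1 + s) + om * (1 - s)) / 2 - om / 5 by clear; lra.
apply: meas_le_two_families.
- by move: om0; clear; lra.
- by move: w0; clear; lra.
- by move: w0'; clear; lra.
- move=> i j /andP[ij _]; apply: push_sep => //; apply: le_trans w0.
  by move: om0; clear; lra.
- move=> i j /andP[ij _]; apply: push_sep => //; apply: le_trans w0'.
  by move: om0; clear; lra.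
Qed.
End Crossing.

(** * From rectifiable curves to segments *)

Section Segments.
Context {R : realType}.
Implicit Types (u v p q : pt R).

Definition dot u p : R := u.1 * p.1 + u.2 * p.2.
Definition nrm v : R := Num.sqrt (v.1 ^+ 2 + v.2 ^+ 2).
Definition vsub p q : pt R := (p.1 - q.1, p.2 - q.2).
Definition nrm1 u : R := `|u.1| + `|u.2|.

Lemma edistE p q : Defs.edist p q = nrm (vsub p q). Proof. by []. Qed.

Lemma nrm_ge0 v : 0 <= nrm v. Proof. exact: sqrtr_ge0. Qed.
Lemma nrm1_ge0 u : 0 <= nrm1 u. Proof. by rewrite addr_ge0. Qed.

Lemma sqr_nrm v : nrm v ^+ 2 = v.1 ^+ 2 + v.2 ^+ 2.
Proof. by rewrite sqr_sqrtr // addr_ge0 ?sqr_ge0. Qed.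

Lemma ler_of_sqr (x y : R) : 0 <= y -> x ^+ 2 <= y ^+ 2 -> x <= y.
Proof.
move=> y0 h; have [x0|x0] := leP x 0; first exact: le_trans y0.
by rewrite -(@ler_pXn2r _ 2) // nnegrE ltW.
Qed.

Lemma dot_le_nrm p q : dot p q <= nrm p * nrm q.
Proof.
apply: ler_of_sqr; first by rewrite mulr_ge0 ?nrm_ge0.
rewrite exprMn !sqr_nrm /dot -subr_ge0.
by rewrite (_ : _ - _ = (p.1 * q.2 - p.2 * q.1) ^+ 2) ?sqr_ge0 //; ring.
Qed.

Lemma normr_dot_le u p : `|dot u p| <= nrm1 u * nrm p.
Proof.
have a : `|p.1| <= nrm p.
  by apply: ler_of_sqr; rewrite ?nrm_ge0 // sqr_nrm real_normK ?num_real // lerDl sqr_ge0.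
have b : `|p.2| <= nrm p.
  by apply: ler_of_sqr; rewrite ?nrm_ge0 // sqr_nrm real_normK ?num_real // lerDr sqr_ge0.
apply: le_trans (ler_normD _ _) _; rewrite !normrM mulrDl.
by apply: lerD; apply: ler_wpM2l.
Qed.

(* Reflecting [q] in the line orthogonal to [u] makes the path [p] then [q]
   overshoot by twice the depth [f] in the direction [u]. *)
Lemma overshoot_sqr u p q (f : R) : 0 <= f ->
  f + `|dot u p + dot u q| / 2 <= `|dot u p - dot u q| / 2 ->
  (2 * f) ^+ 2 <= nrm u ^+ 2 * ((nrm p + nrm q) ^+ 2 - (dot p p + dot q q + 2 * dot p q)).
Proof.
move=> f0 h.
set x := dot u p in h *; set y := dot u q in h *.
have xy : (2 * f) ^+ 2 <= - 4 * (x * y).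
  have h1 : (2 * f + `|x + y|) ^+ 2 <= `|x - y| ^+ 2.
    rewrite ler_pXn2r ?nnegrE //; first by lra.
    by have := normr_ge0 (x + y); lra.
  have h2 : 0 <= 4 * f * `|x + y| by rewrite !mulr_ge0.
  have h3 : `|x + y| ^+ 2 = (x + y) ^+ 2 by rewrite real_normK ?num_real.
  have h4 : `|x - y| ^+ 2 = (x - y) ^+ 2 by rewrite real_normK ?num_real.
  by rewrite h4 in h1; nra.
pose x' := u.1 * p.2 - u.2 * p.1; pose y' := u.1 * q.2 - u.2 * q.1.
have eX : nrm u ^+ 2 * nrm p ^+ 2 = x ^+ 2 + x' ^+ 2.
  by rewrite !sqr_nrm /x /x' /dot; ring.
have eY : nrm u ^+ 2 * nrm q ^+ 2 = y ^+ 2 + y' ^+ 2.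
  by rewrite !sqr_nrm /y /y' /dot; ring.
have ed : nrm u ^+ 2 * dot p q = x * y + x' * y'.
  by rewrite sqr_nrm /x /y /x' /y' /dot; ring.
have epp : dot p p = nrm p ^+ 2 by rewrite sqr_nrm /dot; ring.
have eqq : dot q q = nrm q ^+ 2 by rewrite sqr_nrm /dot; ring.
have key : - (x * y) + x' * y' <= nrm u ^+ 2 * (nrm p * nrm q).
  apply: ler_of_sqr; first by rewrite !mulr_ge0 ?sqr_ge0 ?nrm_ge0.
  have -> : (nrm u ^+ 2 * (nrm p * nrm q)) ^+ 2 =
    (nrm u ^+ 2 * nrm p ^+ 2) * (nrm u ^+ 2 * nrm q ^+ 2) by ring.
  rewrite eX eY -subr_ge0.
  by rewrite (_ : _ - _ = (x * y' + x' * y) ^+ 2) ?sqr_ge0 //; ring.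
rewrite epp eqq.
have -> : nrm u ^+ 2 * ((nrm p + nrm q) ^+ 2 - (nrm p ^+ 2 + nrm q ^+ 2 + 2 * dot p q)) =
  2 * (nrm u ^+ 2 * (nrm p * nrm q)) - 2 * (nrm u ^+ 2 * dot p q) by ring.
by rewrite ed; lra.
Qed.

(** A segment is stored as its midpoint and its vector, so that its shadow has an explicit centre
    and width. *)
Definition seg := (pt R * pt R)%type.
Definition shadow u (s : seg) : set R := [set t | `|t - dot u s.1| <= `|dot u s.2| / 2].

Definition chord p q : seg := (((p.1 + q.1) / 2, (p.2 + q.2) / 2), vsub q p).

(** The distance from the projection of [a] to the shadow of the chord. *)
Definition overshoot u p q a : R :=
  Num.max 0 (`|dot u a - dot u (chord p q).1| - `|dot u (chord p q).2| / 2).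

Lemma nrm_vsubC p q : nrm (vsub p q) = nrm (vsub q p).
Proof. by rewrite /nrm /vsub /=; congr Num.sqrt; ring. Qed.

(** Let [l] be the length of the path from [p] over [a] to [q], and [V] that of the chord. By
    [overshoot_sqr] the overshoot is controlled by the geometric mean of [l + V] and [l - V]; the
    inequality of the means with weight [tau] makes the bound linear, so that it can be summed over
    a subdivision. *)
Lemma overshoot_le u p q a (tau : R) : 0 < tau ->
  2 * overshoot u p q a <= nrm1 u / 2 *
    (tau * (Defs.edist p a + Defs.edist a q + Defs.edist p q) +
     (Defs.edist p a + Defs.edist a q - Defs.edist p q) / tau).
Proof.
move=> tau0; rewrite !edistE.
set l := nrm (vsub p a) + nrm (vsub a q); set V := nrm (vsub p q).
pose r := vsub a p; pose s := vsub q a.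
have lE : l = nrm r + nrm s by rewrite /l nrm_vsubC (nrm_vsubC a q).
have VE : V ^+ 2 = dot r r + dot s s + 2 * dot r s.
  by rewrite /V sqr_nrm /dot /r /s /vsub /=; ring.
have Vl : V <= l.
  apply: ler_of_sqr; first by rewrite addr_ge0 ?nrm_ge0.
  have epp : dot r r = nrm r ^+ 2 by rewrite sqr_nrm /dot; ring.
  have eqq : dot s s = nrm s ^+ 2 by rewrite sqr_nrm /dot; ring.
  have := dot_le_nrm r s; rewrite VE lE epp eqq => h.
  have -> : (nrm r + nrm s) ^+ 2 = nrm r ^+ 2 + nrm s ^+ 2 + 2 * (nrm r * nrm s) by ring.
  by lra.
have V0 : 0 <= V := nrm_ge0 _.
have h0 : 0 <= tau * (l + V) + (l - V) / tau.
  by apply: addr_ge0; [apply: mulr_ge0; lra|apply: divr_ge0; lra].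
have u0 := nrm1_ge0 u.
apply: ler_of_sqr; first by rewrite mulr_ge0 // divr_ge0.
have amgm : (l + V) * (l - V) <= ((tau * (l + V) + (l - V) / tau) / 2) ^+ 2.
  rewrite -subr_ge0.
  rewrite (_ : _ - _ = ((tau * (l + V) - (l - V) / tau) / 2) ^+ 2) ?sqr_ge0 //.
  by field; rewrite gt_eqF.
have nu : nrm u ^+ 2 <= nrm1 u ^+ 2.
  rewrite sqr_nrm /nrm1 sqrrD !real_normK ?num_real //.
  by have : 0 <= `|u.1| * `|u.2| by []; rewrite -mulr_natr; lra.
apply: (@le_trans _ _ (nrm u ^+ 2 * ((l + V) * (l - V)))).
  rewrite /overshoot; set f := (`|_ - _| - _ / 2); case: (leP 0 f) => [hle|hlt]; last first.
    by rewrite mulr0 expr0n /= mulr_ge0 ?sqr_ge0 ?mulr_ge0 //; lra.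
  have -> : (l + V) * (l - V) = (nrm r + nrm s) ^+ 2 - (dot r r + dot s s + 2 * dot r s).
    by rewrite -VE -lE; ring.
  apply: overshoot_sqr => //.
  have -> : dot u r + dot u s = dot u (chord p q).2.
    by rewrite /dot /r /s /vsub /=; ring.
  have -> : dot u r - dot u s = 2 * (dot u a - dot u (chord p q).1).
    by rewrite /dot /r /s /vsub /=; field.
  by rewrite normrM ger0_norm // /f; lra.
have -> : (nrm1 u / 2 * (tau * (l + V) + (l - V) / tau)) ^+ 2 =
   nrm1 u ^+ 2 * ((tau * (l + V) + (l - V) / tau) / 2) ^+ 2 by ring.
by apply: ler_pM; rewrite ?sqr_ge0 ?mulr_ge0 //; lra.
Qed.

Lemma shadow_overshoot u p q a (e : R) : overshoot u p q a <= e ->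
  shadow u (chord p q) (dot u a) \/
  `[dot u (chord p q).1 - `|dot u (chord p q).2| / 2 - e,
    dot u (chord p q).1 - `|dot u (chord p q).2| / 2]%classic (dot u a) \/
  `[dot u (chord p q).1 + `|dot u (chord p q).2| / 2,
    dot u (chord p q).1 + `|dot u (chord p q).2| / 2 + e]%classic (dot u a).
Proof.
rewrite /overshoot ge_max => /andP[e0 h].
have [|lt] := leP `|dot u a - dot u (chord p q).1| (`|dot u (chord p q).2| / 2); first by left.
right; move: h lt; rewrite /= !in_itv /=.
case: (leP 0 (dot u a - dot u (chord p q).1)) => hs.
  by rewrite ger0_norm // => h lt; right; apply/andP; lra.
by rewrite ltr0_norm // => h lt; left; apply/andP; lra.
Qed.

End Segments.

(** * Replacing the curves by finitely many chords *)

Section Curves.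
Context {R : realType}.
Implicit Types (u v p q : pt R) (g : R -> pt R).

Definition covered (S : seq (@seg R)) (E : set R) u p : Prop :=
  E (dot u p) \/ exists2 s, s \in S & shadow u s (dot u p).

Definition chain_length g (s : nat -> R) n := \sum_(i < n) Defs.edist (g (s i)) (g (s i.+1)).

Definition subdivision (s : nat -> R) n :=
  [/\ s 0%N = 0, s n = 1 & forall i, (i < n)%N -> s i <= s i.+1].

Lemma chain_length_le g s n l : curve_length g = l%:E -> subdivision s n ->
  chain_length g s n <= l.
Proof.
move=> gl [s0 s1 sm]; rewrite -lee_fin -gl; apply: ereal_sup_ubound.
by exists n, s.
Qed.

Lemma big_double (F : nat -> R) n :
  \sum_(i < n.*2) F i = \sum_(i < n) (F i.*2 + F i.*2.+1).
Proof.
elim: n => [|n IH]; first by rewrite !big_ord0.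
by rewrite doubleS !big_ord_recr /= IH addrA.
Qed.

Lemma refined_length_le g s n l (t : nat -> R) : curve_length g = l%:E -> subdivision s n ->
  (forall k, (k < n)%N -> s k <= t k <= s k.+1) ->
  \sum_(k < n) (Defs.edist (g (s k)) (g (t k)) + Defs.edist (g (t k)) (g (s k.+1))) <= l.
Proof.
move=> gl [s0 s1 sm] ht.
pose s' i := if odd i then t i./2 else s i./2.
have s'e k : s' k.*2 = s k by rewrite /s' odd_double doubleK.
have s'o k : s' k.*2.+1 = t k by rewrite /s' /= odd_double /= uphalf_double.
have : chain_length g s' n.*2 <= l.
  apply: chain_length_le gl _; split; rewrite ?s'e //.
  move=> i lt; have lt' : (i./2 < n)%N by rewrite ltn_half_double.
  have /andP[h1 h2] := ht _ lt'.
  rewrite -(odd_double_half i); case: (odd i); first by rewrite add1n s'o -doubleS s'e.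
  by rewrite add0n s'o s'e.
rewrite /chain_length (big_double (fun i => Defs.edist (g (s' i)) (g (s' i.+1)))); apply: le_trans.
rewrite le_eqVlt; apply/orP; left; apply/eqP.
by apply: eq_bigr => k _; rewrite -doubleS !s'e s'o.
Qed.

Lemma subdivision_mem s n t : subdivision s n -> 0 <= t <= 1 ->
  exists2 k, (k < n)%N & s k <= t <= s k.+1.
Proof.
move=> [s0 s1 _]; rewrite -{1}s0 -{1}s1 => {}h.
have n0 : (0 < n)%N by case: (posnP n) s1 => // ->; rewrite s0 => /eqP; rewrite eq_sym oner_eq0.
elim: n n0 h {s1} => // n IH _ /andP[h0 h1].
case: (leP (s n) t) => [le|lt]; first by exists n => //; rewrite le h1.
have [n0|n0] := posnP n; first by move: lt; rewrite n0 ltNge h0.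
have [|k kn hk] := IH n0; first by rewrite h0 ltW.
by exists k => //; rewrite ltnW.
Qed.

Lemma edist_ge0 p q : 0 <= Defs.edist p q.
Proof. exact: sqrtr_ge0. Qed.

(** Take the chords of a subdivision that is almost as long as the curve. If the curve overshot
    their shadows by much in some direction, inserting the overshooting points would make the
    subdivision longer than the curve. *)
Lemma curve_segments g l eps : 0 < eps -> curve_length g = l%:E ->
  exists S : seq (@seg R), \sum_(s <- S) nrm s.2 <= l /\
  forall u, exists2 E, meas_le (eps * nrm1 u) E &
    forall t, 0 <= t <= 1 -> covered S E u (g t).
Proof.
move=> eps0 gl.
have l0 : 0 <= l.
  have := @chain_length_le g (fun i => i%:R) 1 l gl.
  rewrite /chain_length big_ord1 => h; apply: le_trans (h _); first exact: edist_ge0.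
  by split=> // i; rewrite ltnS leqn0 => /eqP -> /=; exact: ler01.
(* With this [tau], and a subdivision that falls short by less than [tau * eps / 2], each of the two
   terms of [overshoot_le] sums to at most [eps / 2]. *)
pose tau := eps / (4 * (l + 1)).
have tau0 : 0 < tau by rewrite divr_gt0 // mulr_gt0 //; lra.
have tauE : tau * (4 * (l + 1)) = eps by rewrite divfK // gt_eqF // mulr_gt0 //; lra.
have [n [s [ssub hs]]] : exists n s, subdivision s n /\ l - tau * eps / 2 < chain_length g s n.
  have e1 : 0 < tau * eps / 2 by rewrite divr_gt0 // mulr_gt0.
  have fin : ereal_sup [set x : \bar R | exists (n : nat) (s : nat -> R),
     [/\ s 0%N = 0, s n = 1, (forall i, (i < n)%N -> s i <= s i.+1)
        & x = (\sum_(i < n) Defs.edist (g (s i)) (g (s i.+1)))%:E]] \is a fin_num.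
    by rewrite -/(curve_length g) gl.
  have [x [n [s [h1 h2 h3 ->]]]] := ub_ereal_sup_adherent e1 fin.
  by rewrite -/(curve_length g) gl -EFinB lte_fin => h; exists n, s.
have [s0 s1 sm] := ssub.
pose c k := chord (g (s k)) (g (s k.+1)).
exists [seq c k | k <- iota 0 n]; split.
  rewrite big_map -{1}(subn0 n) big_mkord.
  apply: le_trans (chain_length_le _ _ _ _ gl ssub); apply: ler_sum => k _.
  by rewrite edistE nrm_vsubC.
move=> u; have u0 := nrm1_ge0 u.
pose f k t := overshoot u (g (s k)) (g (s k.+1)) (g t).
pose X k := [set f k t | t in [set t | s k <= t <= s k.+1]].
have fub k t : (k < n)%N -> s k <= t <= s k.+1 -> f k t <= nrm1 u * l.
  move=> kn ht; have := overshoot_le u (g (s k)) (g (s k.+1)) (g t) _ (@ltr01 R).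
  have : Defs.edist (g (s k)) (g t) + Defs.edist (g t) (g (s k.+1)) <= l.
    have ht' j : (j < n)%N -> s j <= (if j == k then t else s j) <= s j.+1.
      by move=> jn; case: eqP => [->//|_]; rewrite lexx sm.
    have := refined_length_le _ _ _ _ _ gl ssub ht'; apply: le_trans.
    rewrite (bigD1 (Ordinal kn)) //= eqxx lerDl; apply: sumr_ge0 => j _.
    by rewrite addr_ge0 ?edist_ge0.
  rewrite /f mul1r divr1; set A := Defs.edist _ _; set B := Defs.edist _ _ => h h'.
  have := ler_wpM2l u0 h; have : 0 <= nrm1 u * (A + B) by rewrite mulr_ge0 // addr_ge0 ?edist_ge0.
  by move: h'; clear; lra.
have Xsup k : (k < n)%N -> has_sup (X k).
  move=> kn; split; first by exists (f k (s k)), (s k) => //=; rewrite lexx sm.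
  by exists (nrm1 u * l) => _ [t ht <-]; exact: fub.
have f0 k t : 0 <= f k t by rewrite /f /overshoot le_max lexx.
(* On each piece, a parameter that reaches at least half of the largest overshoot. *)
have /choice[t ht] : forall k, exists t, (k < n)%N -> s k <= t <= s k.+1 /\ sup (X k) <= 2 * f k t.
  move=> k; have [kn|] := ltnP k n; last by exists 0.
  have [e0|e0] := leP (sup (X k)) 0.
    by exists (s k) => _; rewrite lexx sm //; split=> //; apply: le_trans e0 _; rewrite mulr_ge0.
  have e2 : 0 < sup (X k) / 2 by lra.
  have [_ [t ht <-] lt] := sup_adherent e2 (Xsup k kn).
  by exists t => _; split=> //; lra.
pose e k := sup (X k).
have e0 k : (k < n)%N -> 0 <= e k.
  move=> kn; apply: le_trans (f0 k (s k)) _; apply: (sup_upper_bound (Xsup k kn)).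
  by exists (s k) => //=; rewrite lexx sm.
pose E k := `[dot u (c k).1 - `|dot u (c k).2| / 2 - e k, dot u (c k).1 - `|dot u (c k).2| / 2]%classic `|`
  `[dot u (c k).1 + `|dot u (c k).2| / 2, dot u (c k).1 + `|dot u (c k).2| / 2 + e k]%classic.
have [F [mF EF]] : exists F, meas_le (\sum_(k <- iota 0 n) (e k + e k)) F /\
    forall k, k \in iota 0 n -> E k `<=` F.
  apply: meas_le_seq => k; rewrite mem_iota add0n => /andP[_ kn].
  apply: meas_leU.
    by apply: meas_leW (meas_le_cc _ _ _) _; have := e0 k kn; lra.
  by apply: meas_leW (meas_le_cc _ _ _) _; have := e0 k kn; lra.
exists F.
  apply: meas_leW mF _.
  pose A k := Defs.edist (g (s k)) (g (t k)) + Defs.edist (g (t k)) (g (s k.+1)).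
  pose V k := Defs.edist (g (s k)) (g (s k.+1)).
  have hA : \sum_(k < n) A k <= l.
    by apply: (refined_length_le _ _ _ _ _ gl ssub) => k /(ht k)[].
  have hV : \sum_(k < n) V k <= l by exact: chain_length_le gl ssub.
  have hV' : l - tau * eps / 2 < \sum_(k < n) V k by [].
  have step k : (k < n)%N -> e k + e k <= nrm1 u * (tau * (A k + V k) + (A k - V k) / tau).
    move=> kn; have [_ h] := ht k kn.
    have := overshoot_le u (g (s k)) (g (s k.+1)) (g (t k)) _ tau0.
    by rewrite -/(f k (t k)) -/(A k) -/(V k); move: h; rewrite /e; clear; lra.
  apply: (@le_trans _ _ (nrm1 u * (tau * (\sum_(k < n) A k + \sum_(k < n) V k) +
      (\sum_(k < n) A k - \sum_(k < n) V k) / tau))).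
    rewrite -{1}(subn0 n) big_mkord -sumrB -big_split /= mulr_sumr mulr_suml -big_split mulr_sumr /=.
    by apply: ler_sum => k _; apply: step.
  rewrite mulrC; apply: ler_wpM2r => //.
  have h1 : (\sum_(k < n) A k - \sum_(k < n) V k) / tau <= eps / 2.
    by rewrite ler_pdivrMr //; move: hA hV'; clear; lra.
  have h2 : tau * (\sum_(k < n) A k + \sum_(k < n) V k) <= tau * (2 * (l + 1)).
    by apply: ler_wpM2l; [exact: ltW|move: hA hV; clear; lra].
  by move: h1 h2 tauE; clear; lra.
move=> t' /(subdivision_mem _ _ _ ssub)[k kn ht'].
have fe : overshoot u (g (s k)) (g (s k.+1)) (g t') <= e k.
  by apply: (sup_upper_bound (Xsup k kn)); exists t'.
have kin : k \in iota 0 n by rewrite mem_iota add0n kn.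
have [h|h] := shadow_overshoot _ _ _ _ _ fe.
  by right; exists (c k) => //; apply/mapP; exists k.
by left; apply: (EF k kin); case: h => h; [left|right].
Qed.

(** What survives of the barrier property for finitely many segments. The exceptional set may depend
    on the direction, the segments may not. *)
Definition near_cover eps (S : seq (@seg R)) : Prop :=
  forall u, exists2 E, meas_le (eps * nrm1 u) E &
    forall q, @unit_square R q -> covered S E u q.

Lemma curves_segments (S : set nat) (g : nat -> R -> pt R) (l : nat -> R) n eps :
  (forall i, S i -> curve_length (g i) = (l i)%:E) -> 0 < eps ->
  exists Z : seq (@seg R), \sum_(s <- Z) nrm s.2 <= \sum_(i < n | (i : nat) \in S) l i /\
  forall u, exists2 E, meas_le (eps * nrm1 u) E &
    forall i t, (i < n)%N -> S i -> 0 <= t <= 1 -> covered Z E u (g i t).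
Proof.
move=> gl; elim: n eps => [|n IH] eps eps0.
  exists [::]; rewrite big_nil big_ord0; split=> // u; exists set0 => //.
  by apply: meas_leW meas_le0 _; rewrite mulr_ge0 ?nrm1_ge0 ?ltW.
have e2 : 0 < eps / 2 by lra.
have -> : \sum_(i < n.+1 | (i : nat) \in S) l i =
    \sum_(i < n | (i : nat) \in S) l i + (if n \in S then l n else 0).
  by rewrite big_mkcond big_ord_recr /= -big_mkcond.
have [Z [lZ hZ]] := IH _ e2.
have [Sn|Sn] := pselect (S n); last first.
  exists Z; rewrite memNset // addr0; split=> // u.
  have [E mE hE] := hZ u; exists E.
    by apply: meas_leW mE _; apply: ler_wpM2r; rewrite ?nrm1_ge0 //; lra.
  move=> i t; rewrite ltnS leq_eqVlt => /orP[/eqP ->|]; [by []|exact: hE].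
have [Z' [lZ' hZ']] := curve_segments _ _ _ e2 (gl n Sn).
exists (Z ++ Z'); rewrite big_cat mem_set //.
split=> [|u]; first exact: lerD.
have [E mE hE] := hZ u; have [E' mE' hE'] := hZ' u.
exists (E `|` E'); first by apply: meas_leW (meas_leU _ _ _ _ mE mE') _; lra.
move=> i t; rewrite ltnS leq_eqVlt => /orP[/eqP ->|lt] Si t01.
  have [h|[s sZ h]] := hE' t t01; first by left; right.
  by right; exists s => //; rewrite mem_cat sZ orbT.
have [h|[s sZ h]] := hE i t lt Si t01; first by left; left.
by right; exists s => //; rewrite mem_cat sZ.
Qed.

Lemma barrier_dot (B : set (pt R)) u q : barrier (@unit_square R) B -> u != (0, 0) ->
  unit_square q -> exists2 b, B b & dot u b = dot u q.
Proof.
move=> bar u0 qU.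
have v0 : (- u.2, u.1) != (0, 0) :> R * R.
  apply: contraNneq u0 => -[/eqP]; rewrite oppr_eq0 => /eqP u2 u1.
  by case: u u1 u2 => ? ? /= -> ->.
have [|b [[t ->] Bb]] := bar q _ v0.
  by exists q; split=> //; exists 0; rewrite !mul0r !addr0; case: (q).
by exists (q.1 + t * - u.2, q.2 + t * u.1) => //; rewrite /dot /=; ring.
Qed.

(** For the curves in the tail of the series: each is enclosed in one interval around the projection
    of its starting point. *)
Lemma curve_near_start g l u t : curve_length g = l%:E -> 0 <= t <= 1 ->
  `|dot u (g t) - dot u (g 0)| <= nrm1 u * l.
Proof.
move=> gl /andP[t0 t1].
have sb : subdivision (fun i => if i is 0%N then 0 else if i is 1%N then t else 1) 2.
  by split=> // -[|[|i]] //=.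
have := chain_length_le _ _ _ _ gl sb; rewrite /chain_length !big_ord_recl big_ord0 addr0 /= => h.
have -> : dot u (g t) - dot u (g 0) = dot u (vsub (g t) (g 0)) by rewrite /dot /vsub /=; ring.
apply: le_trans (normr_dot_le _ _) _; apply: ler_wpM2l; first exact: nrm1_ge0.
apply: le_trans h; rewrite nrm_vsubC lerDl; exact: edist_ge0.
Qed.

Lemma curve_length_ge0 g : (0 <= curve_length g)%E.
Proof.
have h : (0 <= (chain_length g (fun i => i%:R) 1)%:E)%E.
  by rewrite lee_fin sumr_ge0 // => j _; exact: edist_ge0.
apply: le_trans h _; apply: ereal_sup_ubound; exists 1%N, (fun i => i%:R); split=> //.
by move=> j; rewrite ltnS leqn0 => /eqP -> /=; exact: ler01.
Qed.

(** Finitely many curves are replaced by chords. The others have total length at most [eps / 4], so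
    their projections fit into intervals of total length [eps / 2 * nrm1 u]. *)
Lemma barrier_segments (B : set (pt R)) (l eps : R) :
  barrier (@unit_square R) B -> rectifiable_with_length B l%:E -> 0 < eps ->
  exists2 Z : seq (@seg R), \sum_(s <- Z) nrm s.2 <= l & near_cover eps Z.
Proof.
move=> bar [S [g [_ [gfin [_ [BE [lE _]]]]]]] eps0.
have gge0 i : (0 <= curve_length (g i))%E by exact: curve_length_ge0.
pose lr i := fine (curve_length (g i)).
have gl i : S i -> curve_length (g i) = (lr i)%:E.
  by move=> Si; rewrite fineK // ge0_fin_numE // gfin.
have lr0 i : 0 <= lr i by rewrite fine_ge0.
have slt : (\sum_(i <oo | i \in S) curve_length (g i) < +oo)%E by rewrite -lE ltry.
have tl := nneseries_tail_cvg slt (fun k _ => gge0 k).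
have [n tn] : exists n, (\sum_(n <= k <oo | k \in S) curve_length (g k) <= (eps / 4)%:E)%E.
  have e4 : (0 < (eps / 4)%:E)%E by rewrite lte_fin; lra.
  have := tl _ (open_nbhs_nbhs (conj (@open_ereal_lt_ereal R (eps / 4)%:E) e4)).
  by move=> [N _ hN]; exists N; apply: ltW; apply: (hN N) => /=.
have e2 : 0 < eps / 2 by lra.
have [Z [lZ hZ]] := curves_segments S g lr n _ gl e2.
exists Z.
  apply: le_trans lZ _; rewrite -lee_fin lE -sumEFin.
  rewrite (nneseries_split_cond 0 n) // add0n big_mkord.
  rewrite (eq_bigr (fun i : 'I_n => curve_length (g i))); last first.
    by move=> i /set_mem Si; rewrite gl.
  by rewrite leeDl // nneseries_ge0.
move=> u; have u0 := nrm1_ge0 u.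
(* The zero vector is orthogonal to no particular line, but it projects everything to 0. *)
have [uE|un0] := eqVneq u (0, 0).
  exists `[0, 0]%classic.
    by apply: meas_leW (meas_le_cc _ _ (lexx 0)) _; rewrite subrr mulr_ge0 // ltW.
  by move=> q _; left; rewrite /= in_itv /= uE /dot /= !mul0r addr0 lexx.
have [E mE hE] := hZ u.
pose F j := if (j + n)%N \in S then
  `[dot u (g (j + n)%N 0) - nrm1 u * lr (j + n)%N, dot u (g (j + n)%N 0) + nrm1 u * lr (j + n)%N]%classic
  else set0.
exists (E `|` \bigcup_j F j).
  apply: (@meas_leW _ (eps / 2 * nrm1 u + eps / 2 * nrm1 u)); last by lra.
  apply: meas_leU => //.
  pose m j := ((2 * nrm1 u)%:E * (if (j + n)%N \in S then curve_length (g (j + n)%N) else 0))%E.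
  apply: (meas_le_bigcup _ m).
  - by move=> j; rewrite /F; case: ifP.
  - move=> j; rewrite /F /m; case: ifP => [/set_mem Sj|_]; last by rewrite measure0 mule0.
    rewrite gl // -EFinM.
    have h : dot u (g (j + n)%N 0) - nrm1 u * lr (j + n)%N <= dot u (g (j + n)%N 0) + nrm1 u * lr (j + n)%N.
      have : 0 <= nrm1 u * lr (j + n)%N by rewrite mulr_ge0.
      by clear; lra.
    have [_ h2] := meas_le_cc _ _ h; apply: le_trans h2 _; rewrite lee_fin.
    by clear; lra.
  - pose f i := (if i \in S then curve_length (g i) else 0)%E.
    have f0 i : (0 <= f i)%E by rewrite /f; case: ifP.
    rewrite (nneseriesZl (f := fun j => f (j + n)%N)) // nneseries_addn //.
    rewrite eseries_mkcond in tn.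
    have U0 : (0%R <= (2 * nrm1 u)%:E)%E by rewrite lee_fin mulr_ge0.
    apply: le_trans (lee_wpmul2l U0 tn) _.
    by rewrite -EFinM lee_fin; clear; lra.
move=> q qU.
rewrite /covered; have [b Bb <-] := barrier_dot _ _ _ bar un0 qU.
move: Bb; rewrite BE => -[i Si [t]]; rewrite /= in_itv /= => t01 <-.
have [lt|le] := ltnP i n.
  by have [h|h] := hE i t lt Si t01; [left; left|right].
left; right; exists (i - n)%N => //; rewrite /F subnK // mem_set //= in_itv /=.
have := curve_near_start _ _ u _ (gl i Si) t01.
by move=> /ler_normlP[]; clear => ? ?; apply/andP; lra.
Qed.

End Curves.

(** * Cutting the segments to almost equal size *)

Section Subdivide.
Context {R : realType}.
Implicit Types (u v p q : pt R) (s : @seg R) (Z : seq (@seg R)).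

Definition mnorm v : R := Num.max `|v.1| `|v.2|.

(** Where the midpoint of piece [k] of [n] lies, relative to the midpoint of the segment and in
    units of its vector. *)
Definition offset (n k : nat) : R := (2 * k%:R + 1) / (2 * n%:R) - 1 / 2.

Definition split_seg n s : seq (@seg R) :=
  [seq ((s.1.1 + offset n k * s.2.1, s.1.2 + offset n k * s.2.2),
        (s.2.1 / n%:R, s.2.2 / n%:R)) | k <- iota 0 n].

Lemma split_seg_shadow n s u t : (0 < n)%N -> shadow u s t ->
  exists2 s', s' \in split_seg n s & shadow u s' t.
Proof.
move=> n0; rewrite /shadow /=; set d := dot u s.2; set c := dot u s.1 => ht.
have nn : 0 < n%:R :> R by rewrite ltr0n.
suff [k kn hk] : exists2 k, (k < n)%N & `|t - (c + offset n k * d)| <= `|d| / n%:R / 2.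
  exists ((s.1.1 + offset n k * s.2.1, s.1.2 + offset n k * s.2.2),
        (s.2.1 / n%:R, s.2.2 / n%:R)).
    by apply/mapP; exists k => //; rewrite mem_iota add0n kn.
  rewrite (_ : dot u (_, _) = c + offset n k * d); last by rewrite /c /d /dot /=; ring.
  rewrite (_ : dot u (_, _) = d / n%:R); last by rewrite /d /dot /=; ring.
  by rewrite normrM normfV (gtr0_norm nn).
have [d0|d0] := eqVneq d 0.
  exists 0%N => //; rewrite d0 normr0 !mul0r mulr0 addr0.
  by move: ht; rewrite d0 normr0 mul0r.
(* The position of [t] in the shadow, measured in pieces; the end [y = n] is assigned to the last
   piece. *)
pose y := n%:R * ((t - c) / d + 1 / 2).
have hy : `|(t - c) / d| <= 1 / 2.
  by rewrite normrM normfV ler_pdivrMr ?normr_gt0 // mul1r mulrC.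
have /andP[y0 yn] : 0 <= y <= n%:R.
  move/ler_normlP: hy => [h1 h2]; rewrite /y; apply/andP; split.
    by apply: mulr_ge0; [exact: ltW|lra].
  by rewrite -[leRHS]mulr1; apply: ler_wpM2l; [exact: ltW|lra].
have [k kn /ler_normlP[k1 k2]] : exists2 k, (k < n)%N & `|y - (k%:R + 1 / 2)| <= 1 / 2.
  have [yn'|yn'] := ltP y n%:R.
    have /andP[a b] := truncn_itv y0.
    exists (Num.truncn y); first by rewrite -(ltr_nat R); apply: le_lt_trans yn'.
    by rewrite -natr1 in b; apply/ler_normlP; split; lra.
  exists n.-1; first by rewrite ltn_predL.
  have -> : y = n.-1%:R + 1 by rewrite natr1 prednK //; apply/eqP; rewrite eq_le yn.
  by apply/ler_normlP; split; lra.
exists k => //.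
have -> : t - (c + offset n k * d) = d / n%:R * (y - (k%:R + 1 / 2)).
  by rewrite /y /offset; field; rewrite d0 gt_eqF.
rewrite normrM normrM normfV (gtr0_norm nn).
have -> : `|d| / n%:R / 2 = `|d| / n%:R * (1 / 2) by ring.
apply: ler_wpM2l; first by rewrite divr_ge0 // ltW.
by apply/ler_normlP.
Qed.

Lemma nrm_scale (a : R) v : 0 <= a -> nrm (a * v.1, a * v.2) = a * nrm v.
Proof.
move=> a0; rewrite /nrm /= !exprMn -mulrDr sqrtrM ?sqr_ge0 //.
by rewrite sqrtr_sqr ger0_norm.
Qed.

Lemma sum_nrm_split n s : (0 < n)%N -> \sum_(s' <- split_seg n s) nrm s'.2 = nrm s.2.
Proof.
move=> n0; rewrite big_map /= -{1}(subn0 n) big_mkord.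
have nn : n%:R != 0 :> R by rewrite pnatr_eq0 -lt0n.
rewrite (eq_bigr (fun=> n%:R^-1 * nrm s.2)); last first.
  by move=> k _; rewrite -nrm_scale ?invr_ge0 ?ler0n // (mulrC s.2.1) (mulrC s.2.2).
by rewrite sumr_const card_ord -[LHS]mulr_natl mulrA divff // mul1r.
Qed.

Lemma mnorm_split n s s' : (0 < n)%N -> s' \in split_seg n s -> mnorm s'.2 = mnorm s.2 / n%:R.
Proof.
move=> n0 /mapP[k _ ->]; rewrite /mnorm /= !normrM !normfV normr_nat.
by rewrite maxr_pMl // invr_ge0 ler0n.
Qed.

Lemma mnorm_ge0 v : 0 <= mnorm v. Proof. by rewrite le_max normr_ge0. Qed.

(** The number of pieces exceeds [a / lam] by at most 1, and this 1 is at most [tau * (a / lam)]. *)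
Lemma pieces_size (a lam tau : R) : 0 < lam -> 0 < tau -> lam <= tau * a ->
  lam / (1 + tau) <= a / (Num.truncn (a / lam)).+1%:R <= lam.
Proof.
move=> lam0 tau0 h.
have a0 : 0 < a by rewrite -(pmulr_rgt0 _ tau0); apply: lt_le_trans h.
have q0 : 0 <= a / lam by rewrite divr_ge0 ?ltW.
have /andP[h1 h2] := truncn_itv q0; set n := Num.truncn _ in h1 h2 *.
have n0 : 0 < n.+1%:R :> R by rewrite ltr0n.
apply/andP; split; last first.
  by rewrite ler_pdivrMr // mulrC -ler_pdivrMr // ltW.
have t1 : 0 < 1 + tau by lra.
rewrite ler_pdivrMr // mulrAC ler_pdivlMr //.
have : n%:R * lam <= a by rewrite -ler_pdivlMr.
by rewrite -natr1; lra.
Qed.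

(** [lam] is at most [tau] times the smallest non-zero size. Degenerate segments cannot be cut to
    size and remain an exception. *)
Lemma common_scale Z (lmax tau : R) : 0 < lmax -> 0 < tau ->
  exists2 lam, 0 < lam <= lmax & {in Z, forall s, mnorm s.2 = 0 \/ lam <= tau * mnorm s.2}.
Proof.
move=> l0 t0; elim: Z => [|s Z [lam /andP[lam0 laml] h]]; first by exists lmax; rewrite ?l0 ?lexx.
have [z|z] := eqVneq (mnorm s.2) 0.
  exists lam; rewrite ?lam0 // => s'; rewrite inE => /orP[/eqP ->|/h //]; by left.
have sp : 0 < tau * mnorm s.2 by rewrite mulr_gt0 // lt_neqAle eq_sym z mnorm_ge0.
exists (Num.min lam (tau * mnorm s.2)).
  by rewrite lt_min lam0 sp ge_min laml.
move=> s'; rewrite inE => /orP[/eqP ->|/h [->|h']]; [right|by left|right].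
  by rewrite ge_min lexx orbT.
by rewrite ge_min h'.
Qed.

Lemma subdivide Z eps (lmax tau : R) : near_cover eps Z -> 0 < lmax -> 0 < tau ->
  exists Z' lam, [/\ 0 < lam <= lmax, near_cover eps Z',
    \sum_(s <- Z') nrm s.2 = \sum_(s <- Z) nrm s.2 &
    {in Z', forall s, mnorm s.2 = 0 \/ lam / (1 + tau) <= mnorm s.2 <= lam}].
Proof.
move=> ncov l0 t0; have [lam lamb hlam] := common_scale Z _ _ l0 t0.
have /andP[lam0 _] := lamb.
pose n s := (Num.truncn (mnorm s.2 / lam)).+1.
exists (flatten [seq split_seg (n s) s | s <- Z]), lam; split=> //.
- move=> u; have [E mE hE] := ncov u; exists E => // q qU.
  have [h|[s sZ h]] := hE q qU; [by left|right].
  have [s' s'in h'] := split_seg_shadow (n s) s u _ (ltn0Sn _) h.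
  by exists s' => //; apply/flatten_mapP; exists s.
- by rewrite big_flatten big_map; apply: eq_bigr => s _; rewrite sum_nrm_split.
- move=> s' /flatten_mapP[s sZ s'in]; rewrite (mnorm_split _ _ _ _ s'in) //.
  have [->|h] := hlam s sZ; first by left; rewrite mul0r.
  by right; apply: pieces_size.
Qed.

End Subdivide.

(** * Projections and norms of finite families of segments *)

Section Projections.
Context {R : realType}.
Implicit Types (u v p q : pt R) (s : @seg R) (Z : seq (@seg R)).

Lemma nrm1_pair (a b : R) : nrm1 (a, b) = `|a| + `|b|. Proof. by []. Qed.

(** The left end of the projection of the square, an interval of length [nrm1 u]. *)
Definition square_min u : R := Num.min 0 u.1 + Num.min 0 u.2.

(** One of the diagonals of the square already has the full projection; the signs of [u] tell
    which. *)
Lemma square_proj u t : square_min u <= t <= square_min u + nrm1 u ->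
  exists2 q, unit_square q & dot u q = t.
Proof.
move=> /andP[h1 h2].
pose x := (t - square_min u) / nrm1 u.
have u0 := nrm1_ge0 u.
have x01 : 0 <= x <= 1.
  have [e|e] := eqVneq (nrm1 u) 0; first by rewrite /x e invr0 mulr0 lexx ler01.
  have up : 0 < nrm1 u by rewrite lt_neqAle eq_sym e.
  by rewrite divr_ge0 ?subr_ge0 //= ler_pdivrMr // mul1r lerBlDl.
have xE : nrm1 u * x = t - square_min u.
  have [e|e] := eqVneq (nrm1 u) 0; last by rewrite mulrC divfK.
  by rewrite e mul0r; move: h1 h2; rewrite e; lra.
exists (if 0 <= u.1 then x else 1 - x, if 0 <= u.2 then x else 1 - x).
  by move: x01; rewrite /unit_square /= => /andP[? ?]; split; case: ifP => _; apply/andP; split; lra.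
move: xE; rewrite /dot /square_min /nrm1 /=.
by case: (leP 0 u.1) => a; case: (leP 0 u.2) => b;
  rewrite ?(ger0_norm a) ?(ger0_norm b) ?(ltr0_norm a) ?(ltr0_norm b); lra.
Qed.

Lemma shadow_cc u s : `[dot u s.1 - `|dot u s.2| / 2, dot u s.1 + `|dot u s.2| / 2]%classic
  = shadow u s.
Proof.
apply/seteqP; split=> t; rewrite /shadow /= in_itv /= ler_norml => /andP[? ?];
  by apply/andP; split; lra.
Qed.

(** Only the shadows of [bad] segments can help to cover [[a, b]], so they have to do so up to the
    exceptional set. *)
Lemma interval_bound Z eps u (bad : pred (@seg R)) a b : near_cover eps Z ->
  square_min u <= a -> b <= square_min u + nrm1 u ->
  {in Z, forall s, ~~ bad s -> forall t, shadow u s t -> a <= t <= b -> False} ->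
  b - a <= eps * nrm1 u + \sum_(s <- Z | bad s) `|dot u s.2|.
Proof.
move=> ncov ha hb hbad; have [E mE hE] := ncov u.
have [F [mF hF]] : exists F, meas_le (\sum_(s <- [seq s <- Z | bad s]) `|dot u s.2|) F /\
    forall s, s \in [seq s <- Z | bad s] -> shadow u s `<=` F.
  apply: meas_le_seq => s _; rewrite -shadow_cc.
  have h : dot u s.1 - `|dot u s.2| / 2 <= dot u s.1 + `|dot u s.2| / 2.
    by have := normr_ge0 (dot u s.2); clear; lra.
  by apply: meas_leW (meas_le_cc _ _ h) _; clear; lra.
rewrite big_filter in mF; apply: meas_le_itv_sub (meas_leU _ _ _ _ mE mF) _ => t.
rewrite /= in_itv /= => /andP[ta tb].
have [|q qU qt] := square_proj u t.
  by rewrite (le_trans ha ta) (le_trans tb hb).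
rewrite -qt; have [h|[s sZ h]] := hE q qU; [by left|right].
apply: (hF s) => //; rewrite mem_filter sZ andbT; apply/negPn/negP => nb.
by apply: (hbad s sZ nb _ h); rewrite qt ta tb.
Qed.

Lemma width_bound Z eps u : near_cover eps Z ->
  nrm1 u <= eps * nrm1 u + \sum_(s <- Z) `|dot u s.2|.
Proof.
move=> ncov; have := interval_bound Z eps u xpredT (square_min u) (square_min u + nrm1 u) ncov
  (lexx _) (lexx _).
by rewrite (addrC (square_min u)) addrK; apply.
Qed.

(** Each shadow of [A] is cut into a centred core of width [w s] and two flanks. The cores are paid
    for by [F] alone, so overlaps among them are gained; the flanks and [Z] are counted in full. *)
Lemma core_bound A Z eps u (w : @seg R -> R) e (F : set R) : near_cover eps (A ++ Z) ->
  meas_le e F -> {in A, forall s, `|w s| <= `|dot u s.2|} ->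
  {in A, forall s, half_open (dot u s.1) (w s) `<=` F} ->
  nrm1 u <= eps * nrm1 u + e + \sum_(s <- A) (`|dot u s.2| - w s) + \sum_(s <- Z) `|dot u s.2|.
Proof.
move=> ncov mF hw hF; have [E mE hE] := ncov u.
pose side s := `[dot u s.1 - `|dot u s.2| / 2, dot u s.1 - w s / 2]%classic `|`
  `[dot u s.1 + w s / 2, dot u s.1 + `|dot u s.2| / 2]%classic.
have [G [mG hG]] : exists G, meas_le (\sum_(s <- A) (`|dot u s.2| - w s)) G /\
    forall s, s \in A -> side s `<=` G.
  apply: meas_le_seq => s sA; have := hw s sA => /ler_normlP[h1 h2].
  apply: (@meas_leW _ ((`|dot u s.2| - w s) / 2 + (`|dot u s.2| - w s) / 2)); last by clear; lra.
  apply: meas_leU.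
    have h : dot u s.1 - `|dot u s.2| / 2 <= dot u s.1 - w s / 2 by move: h1 h2; clear; lra.
    by apply: meas_leW (meas_le_cc _ _ h) _; clear; lra.
  have h : dot u s.1 + w s / 2 <= dot u s.1 + `|dot u s.2| / 2 by move: h1 h2; clear; lra.
  by apply: meas_leW (meas_le_cc _ _ h) _; clear; lra.
have [H [mH hH]] : exists H, meas_le (\sum_(s <- Z) `|dot u s.2|) H /\
    forall s, s \in Z -> shadow u s `<=` H.
  apply: meas_le_seq => s _; rewrite -shadow_cc.
  have h : dot u s.1 - `|dot u s.2| / 2 <= dot u s.1 + `|dot u s.2| / 2.
    by have := normr_ge0 (dot u s.2); clear; lra.
  by apply: meas_leW (meas_le_cc _ _ h) _; clear; lra.
have := meas_le_itv_sub (square_min u) (square_min u + nrm1 u) _ _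
  (meas_leU _ _ _ _ (meas_leU _ _ _ _ (meas_leU _ _ _ _ mE mF) mG) mH).
rewrite (addrC (square_min u)) addrK; apply => t; rewrite /= in_itv /= (addrC (nrm1 u)) => ht.
have [q qU qt] := square_proj u t ht.
rewrite -qt; have [h|[s]] := hE q qU; first by left; left; left.
rewrite mem_cat => /orP[sA h|sZ h]; last by right; apply: (hH s).
left; move: h; rewrite -shadow_cc qt /= in_itv /= => /andP[t1 t2].
have [l1|l1] := ltP t (dot u s.1 - w s / 2).
  by right; apply: (hG s sA); left; rewrite /= in_itv /= t1 ltW.
have [l2|l2] := ltP t (dot u s.1 + w s / 2).
  by left; right; apply: (hF s sA); rewrite /half_open /= in_itv /= l1 l2.
by right; apply: (hG s sA); right; rewrite /= in_itv /= l2 t2.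
Qed.

(** Averaging a direction with its mirror image removes the signs: [|x + y| + |x - y|] is twice the
    larger of [|x|] and [|y|]. *)
Lemma normr_dot_reflect (a b : R) v :
  `|dot (a, b) v| + `|dot (a, - b) v| = 2 * Num.max (`|a| * `|v.1|) (`|b| * `|v.2|).
Proof.
rewrite /dot /= mulNr -!normrM.
set x := a * v.1; set y := b * v.2.
case: (ger0P (x + y)); case: (ger0P (x - y)); case: (ger0P x) => hx; case: (ger0P y) => hy h1 h2;
  rewrite /Num.max; case: ltP; lra.
Qed.

Lemma near_cover_perm eps Z Z' : perm_eq Z Z' -> near_cover eps Z -> near_cover eps Z'.
Proof.
move=> pe ncov u; have [E mE hE] := ncov u; exists E => // q /hE[h|[s sZ h]]; first by left.
by right; exists s => //; rewrite -(perm_mem pe).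
Qed.

(** The midpoints of [K] equal parts of the interval from [- 4 / 5] to [4 / 5]: the parameters of
    the directions that are averaged. *)
Definition node (K k : nat) : R := 4 / 5 * ((2 * k%:R + 1) / K%:R - 1).

Lemma sum_node K j : (0 < K)%N ->
  \sum_(k < j) node K k = 4 / 5 * (j%:R ^+ 2 / K%:R - j%:R).
Proof.
move=> K0; have KK : K%:R != 0 :> R by rewrite pnatr_eq0 -lt0n.
elim: j => [|j IH]; first by rewrite big_ord0 expr0n /= !mul0r subrr mulr0.
by rewrite big_ord_recr /= IH /node -natr1; field.
Qed.

(* The vertices [(1 - t + 4/5 t (1 - t), t + 4/5 t (1 - t))], [t = j / K], lie in
   the unit disc; the left-hand side is the support function of their hull. *)
Lemma chain_le_nrm K v : (0 < K)%N ->
  \sum_(k < K) Num.max ((1 + node K k) * `|v.1|) ((1 - node K k) * `|v.2|) <= K%:R * nrm v.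
Proof.
move=> K0; set x := `|v.1|; set y := `|v.2|.
have x0 : 0 <= x by exact: normr_ge0.
have y0 : 0 <= y by exact: normr_ge0.
have KK : 0 < K%:R :> R by rewrite ltr0n.
have nodeh k : node K k <= node K k.+1.
  rewrite /node; apply: ler_wpM2l; first lra.
  by apply: lerB => //; apply: ler_wpM2r; [rewrite invr_ge0 ltW|rewrite -natr1; lra].
(* The nodes increase, so the maximum is the term with [y] before some index [j] and the term with
   [x] from there on. *)
have [j jK ->] : exists2 j, (j <= K)%N &
    \sum_(k < K) Num.max ((1 + node K k) * x) ((1 - node K k) * y) =
    \sum_(k < j) (1 - node K k) * y + (\sum_(k < K) (1 + node K k) * x - \sum_(k < j) (1 + node K k) * x).
  have : forall n, exists2 j, (j <= n)%N &
    (\sum_(k < n) Num.max ((1 + node K k) * x) ((1 - node K k) * y) =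
    \sum_(k < j) (1 - node K k) * y + (\sum_(k < n) (1 + node K k) * x - \sum_(k < j) (1 + node K k) * x))
    /\ (j = n \/ (1 - node K j) * y <= (1 + node K j) * x).
    elim=> [|n [j jn [IH hj]]]; first by exists 0%N => //; rewrite !big_ord0 subrr addr0; split=> //; left.
    have [le|lt] := leP ((1 - node K n) * y) ((1 + node K n) * x).
      exists j; first exact: leqW.
      split; last by case: hj => [->|]; right.
      by rewrite 2!(big_ord_recr n) /= IH (max_l le); ring.
    have jE : j = n.
      case: hj => // le; have nodes : node K j <= node K n.
        by apply: (@homo_leq _ (node K) (fun a b => a <= b)) => //; exact: le_trans.
      have h1 : (1 - node K n) * y <= (1 - node K j) * y by apply: ler_wpM2r => //; lra.
      have h2 : (1 + node K j) * x <= (1 + node K n) * x by apply: ler_wpM2r => //; lra.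
      by exfalso; move: lt le h1 h2; clear; lra.
    exists n.+1 => //; split; last by left.
    rewrite jE subrr addr0 in IH.
    by rewrite 2!(big_ord_recr n) /= IH (max_r (ltW lt)) subrr addr0.
  by move=> /(_ K)[j jK [-> _]]; exists j.
rewrite -!mulr_suml !big_split /= !sumrN !sumr_const !card_ord !sum_node //.
pose t : R := j%:R / K%:R.
have t0 : 0 <= t by rewrite divr_ge0.
have t1 : t <= 1 by rewrite ler_pdivrMr // mul1r ler_nat.
have jE : j%:R = t * K%:R by rewrite divfK // gt_eqF.
pose X := 1 - t + 4 / 5 * (t * (1 - t)); pose Y := t + 4 / 5 * (t * (1 - t)).
rewrite (_ : _ + _ = K%:R * (X * x + Y * y)); last first.
  by rewrite jE /X /Y; field; rewrite gt_eqF.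
apply: ler_wpM2l; first exact: ltW.
apply: ler_of_sqr; first exact: nrm_ge0.
rewrite sqr_nrm -(real_normK (num_real v.1)) -(real_normK (num_real v.2)) -/x -/y.
have h1 : (X * x + Y * y) ^+ 2 <= (X ^+ 2 + Y ^+ 2) * (x ^+ 2 + y ^+ 2).
  rewrite -subr_ge0 (_ : _ - _ = (X * y - Y * x) ^+ 2) ?sqr_ge0 //; ring.
apply: le_trans h1 _; rewrite -[leRHS]mul1r; apply: ler_wpM2r.
  by rewrite addr_ge0 ?sqr_ge0.
have p0 : 0 <= t * (1 - t) by apply: mulr_ge0 => //; move: t1; clear; lra.
have p1 : t * (1 - t) <= 1 / 4.
  by rewrite -subr_ge0 (_ : _ - _ = (t - 1 / 2) ^+ 2) ?sqr_ge0 //; field.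
have -> : X ^+ 2 + Y ^+ 2 = 1 - t * (1 - t) * (2 / 5) + 32 / 25 * (t * (1 - t)) * (t * (1 - t)).
  by rewrite /X /Y; field.
move: p0 p1; set p := t * (1 - t) => p0 p1.
have : p * p <= p * (1 / 4) by apply: ler_wpM2l.
by move: p0; clear; lra.
Qed.

End Projections.

(** * Almost all of the length is almost parallel to a side and close to the square *)

Section Masses.
Context {R : realType}.
Implicit Types (u v p q : pt R) (s : @seg R) (Z : seq (@seg R)).

(* On the quadrant, the support function of the polygon with the vertices [(1, 0)],
   [(9/10, 4/10)], [(4/10, 9/10)], [(0, 1)]; it weights the directions [(1, +-4)],
   [(1, +-1)], [(4, +-1)]. *)
Definition oct (x y : R) : R :=
  1 / 10 * Num.max x (4 * y) + 1 / 2 * Num.max x y + 1 / 10 * Num.max (4 * x) y.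

(** If [x > 4 * y], then [oct x y = x], and [x < 20 * y] makes [n] exceed it by a factor of at least
    [811 / 810]. Between the axes, [oct] is at most [985 / 1000 * n]. If [y] dominates, then
    [oct x y = y] and the gap is only quadratic in [x]; the term [n / 1000] makes up for this. *)
Lemma oct_gap (x y n : R) : 0 <= x -> 0 <= y -> 0 <= n -> n ^+ 2 = x ^+ 2 + y ^+ 2 ->
  oct x y <= n /\ (x < 20 * y -> x <= n / 1000 + 810 * (n - oct x y)).
Proof.
move=> x0 y0 n0 nE; rewrite /oct.
have [a|a] := leP x (4 * y); last first.
  rewrite (max_l (_ : y <= x)); last lra.
  rewrite (max_l (_ : y <= 4 * x)); last lra.
  have xn : x <= n by apply: ler_of_sqr => //; rewrite nE lerDl sqr_ge0.
  split=> [|lt]; first lra.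
  have : x * (811 / 810) <= n.
    apply: ler_of_sqr => //; rewrite nE.
    have : x * x <= (20 * y) * (20 * y) by apply: ler_pM => //; exact: ltW.
    have : 0 <= x * x by rewrite mulr_ge0.
    by clear; lra.
  by lra.
have [b|b] := leP (4 * x) y.
  rewrite (max_r (_ : x <= y)); last lra.
  have yn : y <= n by apply: ler_of_sqr => //; rewrite nE lerDr sqr_ge0.
  split=> [|_]; first lra.
  suff : x + 810 * y <= (810 + 1 / 1000) * n by lra.
  apply: ler_of_sqr; first by move: n0; clear; lra.
  rewrite exprMn nE.
  have : 0 <= (810 * x - y) ^+ 2 by exact: sqr_ge0.
  have : 0 <= x * x by rewrite mulr_ge0.
  have : 0 <= y * y by rewrite mulr_ge0.
  by clear; lra.
suff h : 1 / 10 * (4 * y) + 1 / 2 * Num.max x y + 1 / 10 * (4 * x) <= 985 / 1000 * n.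
  have xn : x <= n by apply: ler_of_sqr => //; rewrite nE lerDl sqr_ge0.
  by split=> [|_]; lra.
apply: ler_of_sqr; first by move: n0; clear; lra.
rewrite exprMn nE.
have : 0 <= (4 * x - 9 * y) ^+ 2 by exact: sqr_ge0.
have : 0 <= (9 * x - 4 * y) ^+ 2 by exact: sqr_ge0.
have : 0 <= x * x by rewrite mulr_ge0.
have : 0 <= y * y by rewrite mulr_ge0.
by clear; case: (leP x y) => _; lra.
Qed.

Definition defect v : R := nrm v - oct `|v.1| `|v.2|.

Lemma nrm_oct v : 0 <= defect v /\
  (`|v.1| < 20 * `|v.2| -> `|v.1| <= nrm v / 1000 + 810 * defect v).
Proof.
have [||||h1 h2] := @oct_gap `|v.1| `|v.2| (nrm v); rewrite ?nrm_ge0 //.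
  by rewrite sqr_nrm !real_normK ?num_real.
by split=> //; rewrite subr_ge0.
Qed.

(** The zero vector is excluded, so that no segment is almost horizontal and almost vertical at
    once. *)
Definition horizontal s := (s.2.1 != 0) && (20 * `|s.2.2| <= `|s.2.1|).
(** Centred more than [3 / 10] above or below the square: the directions [(1, 4)] and [(1, - 4)]
    then project a short segment off the projection of the square. *)
Definition far_off s := (- (5 / 100) <= s.1.1 <= 105 / 100) && (8 / 10 < `|s.1.2 - 1 / 2|).

Lemma normr_le_mnorm v : `|v.1| <= mnorm v /\ `|v.2| <= mnorm v.
Proof. by rewrite !le_max !lexx orbT. Qed.

Lemma shadow_pt (a b : R) s t : `|a| <= 4 -> `|b| <= 4 -> mnorm s.2 <= 1 / 1000 ->
  shadow (a, b) s t -> `|t - (a * s.1.1 + b * s.1.2)| <= 4 / 1000.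
Proof.
move=> ha hb hs; rewrite /shadow /dot /= => /le_trans; apply.
have [h1 h2] := normr_le_mnorm s.2.
have i1 : `|a| * `|s.2.1| <= 4 * (1 / 1000) by apply: ler_pM => //; apply: le_trans hs.
have i2 : `|b| * `|s.2.2| <= 4 * (1 / 1000) by apply: ler_pM => //; apply: le_trans hs.
have := ler_normD (a * s.2.1) (b * s.2.2); rewrite !normrM.
by move: i1 i2; clear; lra.
Qed.

Lemma far_off_shadow (e : R) s t : e = 4 \/ e = - 4 -> far_off s -> mnorm s.2 <= 1 / 1000 ->
  shadow (1, e) s t -> square_min (1, e) <= t <= square_min (1, e) + nrm1 (1, e) -> False.
Proof.
move=> he /andP[/andP[c1 c2] c3] hs sh.
have : `|t - (1 * s.1.1 + e * s.1.2)| <= 4 / 1000.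
  apply: shadow_pt sh => //; first by rewrite normr1; lra.
  by case: he => ->; rewrite ?normrN ger0_norm; lra.
rewrite /square_min /nrm1 /= normr1 (min_l (@ler01 R)).
have n4 : `|4 : R| = 4 by rewrite ger0_norm.
have far : s.1.2 < - (3 / 10) \/ 13 / 10 < s.1.2.
  by move: c3; case: (ger0P (s.1.2 - 1 / 2)) => h1 h2; [right|left]; lra.
move=> /ler_normlP[]; move: far c1 c2; clear -he n4.
have m4 : Num.min 0 (- 4) = - 4 :> R by apply: min_r; lra.
have m4' : Num.min 0 4 = 0 :> R by apply: min_l; lra.
by case: he => ->; rewrite ?normrN n4 ?m4 ?m4' => -[] h c1 c2 h1 h2 /andP[h3 h4]; lra.
Qed.

(** The covering bounds in the six directions of [oct], with its weights, sum to [2 - 2 * eps]. In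
    the two directions [(1, 4)] and [(1, - 4)] the far off segments do not help to cover, so their
    contribution comes on top. *)
Lemma deficit Z eps : near_cover eps Z -> {in Z, forall s, mnorm s.2 <= 1 / 1000} ->
  \sum_(s <- Z) defect s.2 + 1 / 10 * \sum_(s <- Z | far_off s) `|s.2.1| <=
  \sum_(s <- Z) nrm s.2 - 2 + 2 * eps.
Proof.
move=> ncov small.
have far e : e = 4 \/ e = - 4 -> 5 <= eps * 5 + \sum_(s <- Z | ~~ far_off s) `|dot (1, e) s.2|.
  move=> he; have nE : nrm1 (1, e) = 5.
    by rewrite /nrm1 /= normr1; case: he => ->; rewrite ?normrN ger0_norm //; lra.
  have := interval_bound Z eps (1, e) (fun s => ~~ far_off s) _ _ ncov (lexx _) (lexx _).
  rewrite (addrC (square_min _)) addrK nE; apply => s sZ; rewrite negbK => fs t sh ht.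
  by apply: (far_off_shadow _ _ _ he fs (small s sZ) sh); rewrite nE addrC.
have plain a b : nrm1 (a, b) <= eps * nrm1 (a, b) + \sum_(s <- Z) `|dot (a, b) s.2|.
  exact: width_bound.
have two (a b : R) (c : pred (@seg R)) : 0 <= a -> 0 <= b ->
  \sum_(s <- Z | c s) `|dot (a, b) s.2| + \sum_(s <- Z | c s) `|dot (a, - b) s.2| =
  2 * \sum_(s <- Z | c s) Num.max (a * `|s.2.1|) (b * `|s.2.2|).
  move=> a0 b0; rewrite -big_split /= mulr_sumr; apply: eq_bigr => s _.
  by rewrite normr_dot_reflect (ger0_norm a0) (ger0_norm b0).
have p4 : 0 <= 4 :> R by lra.
have p1 : 0 <= 1 :> R by lra.
have i1 := far _ (or_introl erefl); have i2 := far _ (or_intror erefl).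
have i3 := plain 1 1; have i4 := plain 1 (- 1).
have i5 := plain 4 1; have i6 := plain 4 (- 1).
have e1 := two 1 4 (fun s => ~~ far_off s) p1 p4.
have e2 := two 1 1 xpredT p1 p1; have e3 := two 4 1 xpredT p4 p1.
rewrite !nrm1_pair !normrN !(ger0_norm p1) !(ger0_norm p4) in i3 i4 i5 i6.
pose M1 s := Num.max (1 * `|s.2.1|) (4 * `|s.2.2|).
have e4 : \sum_(s <- Z) M1 s = \sum_(s <- Z | far_off s) M1 s + \sum_(s <- Z | ~~ far_off s) M1 s.
  exact: bigID.
have e5 : \sum_(s <- Z | far_off s) `|s.2.1| <= \sum_(s <- Z | far_off s) M1 s.
  by apply: ler_sum => s _; rewrite /M1 mul1r le_max lexx.
have e6 : \sum_(s <- Z) defect s.2 = \sum_(s <- Z) nrm s.2 -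
  (1 / 10 * \sum_(s <- Z) M1 s + 1 / 2 * \sum_(s <- Z) Num.max (1 * `|s.2.1|) (1 * `|s.2.2|)
   + 1 / 10 * \sum_(s <- Z) Num.max (4 * `|s.2.1|) (1 * `|s.2.2|)).
  rewrite !mulr_sumr -!big_split -sumrB /=; apply: eq_bigr => s _.
  by rewrite /defect /oct /M1 !mul1r.
move: i1 i2 i3 i4 i5 i6 e1 e2 e3 e4 e5; rewrite e6 -/M1.
set A := \sum_(s <- Z) M1 s; set B := \sum_(s <- Z) Num.max (1 * _) (1 * _).
set C := \sum_(s <- Z) Num.max (4 * _) _; set D := \sum_(s <- Z | ~~ far_off s) M1 s.
by clear; lra.
Qed.

Definition in_strip (a l : R) s :=
  [&& horizontal s, a - 1 / 1000 <= s.1.1 <= a + l + 1 / 1000 & ~~ far_off s].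

(** In the direction [(1, 0)] the segments over the strip have to cover it. By [deficit] and
    [nrm_oct], those that are far off or not almost horizontal, together with the exceptional set,
    account for at most [2 / 100]; each of the others covers at most [lam]. *)
Lemma strip_mass Z eps lam (a l : R) : near_cover eps Z -> 0 <= eps <= 1 / 10 ^+ 6 ->
  {in Z, forall s, mnorm s.2 <= lam} -> lam <= 1 / 1000 ->
  \sum_(s <- Z) nrm s.2 <= 2 + 2 / 10 ^+ 5 -> 0 <= a -> a + l <= 1 ->
  l - 2 / 100 <= (count (in_strip a l) Z)%:R * lam.
Proof.
move=> ncov /andP[eps0 eps1] szl lamb T a0 al.
have small : {in Z, forall s, mnorm s.2 <= 1 / 1000}.
  by move=> s sZ; apply: le_trans (szl s sZ) lamb.
have def := deficit Z eps ncov small.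
pose I s := a - 1 / 1000 <= s.1.1 <= a + l + 1 / 1000.
have sq : square_min (1 : R, 0 : R) = 0 by rewrite /square_min /= minxx min_l ?addr0.
have n1 : nrm1 (1 : R, 0 : R) = 1 by rewrite /nrm1 /= normr1 normr0 addr0.
have := interval_bound Z eps (1, 0) I a (a + l) ncov.
rewrite sq n1 add0r mulr1 (addrC a) addrK => /(_ a0); rewrite addrC => /(_ al) cov.
have {}cov : l <= eps + \sum_(s <- Z | I s) `|s.2.1|.
  rewrite (eq_bigr (fun s => `|s.2.1|)) in cov; last first.
    by move=> s _; rewrite /dot /= mul1r mul0r addr0.
  apply: cov => s sZ nI t; rewrite /shadow /dot /= !mul1r !mul0r !addr0 => sh ht.
  have [h1 _] := normr_le_mnorm s.2; have h2 := small s sZ.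
  move/negP: nI; apply; apply/andP.
  by move: sh ht => /ler_normlP[? ?] /andP[? ?]; split; move: h1 h2; lra.
pose N s := (~~ horizontal s) && (`|s.2.1| < 20 * `|s.2.2|).
have split3 : \sum_(s <- Z | I s) `|s.2.1| <= \sum_(s <- Z | in_strip a l s) `|s.2.1| +
  \sum_(s <- Z | far_off s) `|s.2.1| + \sum_(s <- Z | N s) `|s.2.1|.
  rewrite big_mkcond [X in X + _ + _]big_mkcond [X in _ + X + _]big_mkcond [X in _ + _ + X]big_mkcond.
  rewrite -!big_split /=; apply: ler_sum => s _.
  case: (boolP (I s)) => hI; last by rewrite !addr_ge0 //; case: ifP.
  have r0 := normr_ge0 s.2.1.
  have [h1|h1] := boolP (far_off s).
    by rewrite -addrA addrCA lerDl addr_ge0 //; case: ifP.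
  have [h2|h2] := boolP (horizontal s).
    by rewrite /in_strip h2 h1 [a - _ <= _ <= _]hI /= addr0 lerDl; case: ifP.
  have [z|nz] := eqVneq s.2.1 0; first by rewrite z normr0 !addr_ge0 //; case: ifP => //; rewrite normr0.
  rewrite /N h2 /=; move: h2; rewrite /horizontal nz /= -ltNge => ->.
  by rewrite lerDr addr_ge0 //; case: ifP.
have hN : \sum_(s <- Z | N s) `|s.2.1| <= (\sum_(s <- Z) nrm s.2) / 1000 + 810 * \sum_(s <- Z) defect s.2.
  rewrite mulr_suml mulr_sumr -big_split /= big_mkcond; apply: ler_sum => s _.
  have [d0 h] := nrm_oct s.2.
  case: ifP => [/andP[_ lt]|_]; first exact: h.
  by have := nrm_ge0 s.2; move: d0; clear; lra.
have hgood : \sum_(s <- Z | in_strip a l s) `|s.2.1| <= (count (in_strip a l) Z)%:R * lam.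
  rewrite -sum1_count natr_sum mulr_suml big_seq_cond [leRHS]big_seq_cond.
  apply: ler_sum => s /andP[sZ _]; rewrite mul1r; apply: le_trans (szl s sZ).
  by have [] := normr_le_mnorm s.2.
have far0 : 0 <= \sum_(s <- Z | far_off s) `|s.2.1| by apply: sumr_ge0.
have def0 : 0 <= \sum_(s <- Z) defect s.2 by apply: sumr_ge0 => s _; case: (nrm_oct s.2).
by move: def cov split3 hN hgood far0 def0 T eps1; clear; lra.
Qed.

End Masses.

(** * Separated families and conclusion *)

Section Final.
Context {R : realType}.
Implicit Types (u v p q : pt R) (s : @seg R) (Z : seq (@seg R)).

(** Reflection in the line [x = y], which preserves the square. *)
Definition swap s : @seg R := ((s.1.2, s.1.1), (s.2.2, s.2.1)).

Lemma near_cover_swap Z eps : near_cover eps Z -> near_cover eps [seq swap s | s <- Z].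
Proof.
move=> ncov [a b]; have [E mE hE] := ncov (b, a); exists E.
  by move: mE; rewrite !nrm1_pair addrC.
move=> [x y] [/= xU yU]; have [//|h|[s sZ h]] := hE (y, x).
  by left; move: h; rewrite /dot /= addrC.
right; exists (swap s); first exact: map_f.
by move: h; rewrite /shadow /dot /= (addrC (b * y)) (addrC (b * _)) (addrC (b * s.2.1)).
Qed.

Lemma nrm_swap s : nrm (swap s).2 = nrm s.2.
Proof. by rewrite /nrm /= addrC. Qed.

Lemma mnorm_swap s : mnorm (swap s).2 = mnorm s.2.
Proof. by rewrite /mnorm /= maxC. Qed.

Lemma horizontal_swap s : horizontal s -> horizontal (swap s) = false.
Proof.
move=> /andP[v0 h]; apply/negP => /andP[_ /= h'].
have : 0 < `|s.2.1| by rewrite normr_gt0.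
by move: h h'; clear; lra.
Qed.

Lemma mnorm_horizontal s : horizontal s -> mnorm s.2 = `|s.2.1|.
Proof.
move=> /andP[_ h]; apply: max_l; have := normr_ge0 s.2.2.
by move: h; clear; lra.
Qed.

Lemma strip_mass_swap Z eps lam (a l : R) : near_cover eps Z -> 0 <= eps <= 1 / 10 ^+ 6 ->
  {in Z, forall s, mnorm s.2 <= lam} -> lam <= 1 / 1000 ->
  \sum_(s <- Z) nrm s.2 <= 2 + 2 / 10 ^+ 5 -> 0 <= a -> a + l <= 1 ->
  l - 2 / 100 <= (count (fun s => in_strip a l (swap s)) Z)%:R * lam.
Proof.
move=> ncov he szl hl T a0 al; rewrite -(count_map swap (in_strip a l)).
apply: (strip_mass _ _ _ _ _ (near_cover_swap _ _ ncov)) => //.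
  by move=> _ /mapP[s sZ ->]; rewrite mnorm_swap szl.
by rewrite big_map (eq_bigr (fun s => nrm s.2)) // => s _; rewrite nrm_swap.
Qed.

Lemma select (T : eqType) (a b : pred T) n m (Z : seq T) :
  (forall x, a x -> ~~ b x) -> (n <= count a Z)%N -> (m <= count b Z)%N ->
  exists P Q rest, [/\ perm_eq Z ((P ++ Q) ++ rest), size P = n, size Q = m,
    {in P, forall x, x \in Z /\ a x} & {in Q, forall x, x \in Z /\ b x}].
Proof.
move=> ab na mb.
pose A := [seq x <- Z | a x]; pose C := [seq x <- Z | ~~ a x].
pose B := [seq x <- C | b x]; pose D := [seq x <- C | ~~ b x].
have BE : B = [seq x <- Z | b x].
  rewrite /B /C -filter_predI; apply: eq_filter => x /=.
  by case: (boolP (a x)) => [/ab/negbTE ->|]; rewrite ?andbF ?andbT.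
exists (take n A), (take m B), (drop n A ++ (drop m B ++ D)); split.
- have h1 : perm_eq Z (A ++ C) by rewrite perm_sym perm_filterC.
  have h2 : perm_eq C (B ++ D) by rewrite perm_sym perm_filterC.
  apply/permP => c; rewrite (permP h1) !count_cat (permP h2) count_cat.
  rewrite -{1}(cat_take_drop n A) -{1}(cat_take_drop m B) !count_cat.
  by rewrite -!addnA; congr addn; rewrite addnCA; congr addn; rewrite addnCA.
- by rewrite size_takel // size_filter.
- by rewrite size_takel // BE size_filter.
- by move=> x /mem_take; rewrite mem_filter => /andP[].
- by move=> x /mem_take; rewrite BE mem_filter => /andP[].
Qed.

(** The factor 9 is the ratio of [1 + 4 / 5] to [1 - 4 / 5], the most unequal coordinates of an
    averaged direction. With slope at most [1 / 20] the second term takes away at most [9 / 20] of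
    the first. *)
Lemma core_width (s1 s2 a b : R) v : `|s1| = 1 -> `|s2| = 1 -> 0 <= a -> 0 <= b <= 9 * a ->
  20 * `|v.2| <= `|v.1| -> 55 / 100 * `|v.1| * a <= `|dot (s1 * a, s2 * b) v|.
Proof.
move=> n1 n2 a0 /andP[b0 ba] h.
have e1 : `|s1 * a * v.1| = a * `|v.1| by rewrite !normrM n1 mul1r (ger0_norm a0).
have e2 : `|s2 * b * v.2| = b * `|v.2| by rewrite !normrM n2 mul1r (ger0_norm b0).
have := lerB_normD (s1 * a * v.1) (s2 * b * v.2); rewrite e1 e2 /dot /=.
have : b * `|v.2| <= 9 * a * `|v.2| by apply: ler_wpM2r.
have : a * (20 * `|v.2|) <= a * `|v.1| by apply: ler_wpM2l.
by clear; lra.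
Qed.

(** The signs [s1] and [s2] reflect the configuration so that [Q] lies to the right of [P] and below
    it. At each node, [core_bound] with the overlaps of [crossing] is added to the plain bound in
    the mirrored direction, and [chain_le_nrm] bounds the average by the length. *)
Lemma pair_length eps lam (P Q rest : seq (@seg R)) (s1 s2 xp0 xp1 yp0 yp1 xq0 xq1 yq0 yq1 : R) :
  near_cover eps ((P ++ Q) ++ rest) -> `|s1| = 1 -> `|s2| = 1 -> 0 < lam <= 1 / 1000 ->
  {in P, forall s, horizontal s /\ lam / (1 + 1 / 100) <= mnorm s.2} ->
  {in Q, forall s, horizontal (swap s) /\ lam / (1 + 1 / 100) <= mnorm s.2} ->
  {in P, forall s, xp0 <= s1 * s.1.1 <= xp1 /\ yp0 <= s2 * s.1.2 <= yp1} ->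
  {in Q, forall s, xq0 <= s1 * s.1.1 <= xq1 /\ yq0 <= s2 * s.1.2 <= yq1} ->
  174 / 1000 <= xq0 - xp1 -> xq1 - xp0 <= 131 / 100 ->
  249 / 1000 <= yp0 - yq1 -> yp1 - yq0 <= 131 / 100 ->
  385 / 10000 <= (size P)%:R * lam <= 39 / 1000 ->
  113 / 1000 <= (size Q)%:R * lam <= 114 / 1000 ->
  2 + 46 / 10 ^+ 6 <= \sum_(s <- (P ++ Q) ++ rest) nrm s.2 + 2 * eps.
Proof.
move=> ncov n1 n2 /andP[lam0 lam1] hP hQ boxP boxQ gx dx gy dy /andP[nP nP'] /andP[nQ nQ'].
(* [54 / 100] is less than [55 / 100] divided by [1 + 1 / 100], so the shadows of all selected
   pieces contain cores of the widths used in [crossing]. *)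
pose om := 54 / 100 * lam.
have om0 : 0 < om by apply: mulr_gt0 => //; clear; lra.
have om1 : om <= 1 / 1000 by rewrite /om; move: lam0 lam1; clear; lra.
(* Enough directions to keep the relative motion per step below [om / 100]. *)
pose K := (Num.truncn (420 / om)).+1.
have KK : 0 < K%:R :> R by rewrite ltr0n.
have hK : 420 <= K%:R * om.
  have q0 : 0 <= 420 / om by apply: divr_ge0; [clear; lra|exact: ltW].
  by have /andP[_ h] := truncn_itv q0; rewrite -ler_pdivrMr // ltW.
pose h := 8 / 5 / K%:R : R.
have hKE : K%:R * h = 8 / 5 by rewrite /h mulrC divfK // gt_eqF.
have h0 : 0 < h by apply: divr_gt0 => //; clear; lra.
have hom : 262 / 100 * h <= 1 / 100 * om.
  rewrite -(ler_pM2l KK) mulrCA hKE; move: hK; clear; lra.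
have h1 : h <= 1 / 50 by move: hom om1; clear; lra.
(* Half a step inside, so that the parameters are the nodes; position [K], half a step beyond
   [4 / 5], only ends the crossing. *)
pose s0 := - 4 / 5 + h / 2.
have nodeE k : s0 + k%:R * h = node K k.
  by rewrite /s0 /h /node; field; rewrite gt_eqF.
have s0K : s0 + K%:R * h = 4 / 5 + h / 2 by rewrite hKE /s0; clear; lra.
pose tr s : R * R := (s1 * s.1.1, s2 * s.1.2).
have [||||||||||N [hN hF]] := crossing [seq tr s | s <- P] [seq tr s | s <- Q] om h s0 K
  xp0 xp1 yp0 yp1 xq0 xq1 yq0 yq1 _ _ _ _ gx dx gy dy.
- by rewrite om0.
- exact: ltW.
- by move=> _ /mapP[s /boxP hs ->].
- by move=> _ /mapP[s /boxQ hs ->].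
- by rewrite size_map /om; move: nP'; clear; lra.
- by rewrite size_map /om; move: nQ'; clear; lra.
- by rewrite /s0; move: h0 h1; clear => ? ?; apply/andP; split; lra.
- by rewrite s0K; move: h0 h1; clear => ? ?; apply/andP; split; lra.
- move=> k kK; have : k.+1%:R * h <= K%:R * h by apply: ler_wpM2r; [exact: ltW|rewrite ler_nat].
  by rewrite hKE /s0 -natr1; move: h0; clear; lra.
- by move: hom om0; clear; lra.
rewrite !size_map in hN hF.
set Z := (P ++ Q) ++ rest in ncov *.
pose M k := \sum_(s <- Z) Num.max ((1 + node K k) * `|s.2.1|) ((1 - node K k) * `|s.2.2|).
have step k : (k < K)%N -> 4 + om / 5 * N k <= 4 * eps + 2 * M k.
  move=> kK; have [F [mF [cP cQ]]] := hF k kK.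
  have [sl su] : - (4 / 5) <= node K k :> R /\ node K k <= 4 / 5 :> R.
    have : k.+1%:R * h <= K%:R * h by apply: ler_wpM2r; [exact: ltW|rewrite ler_nat].
    have : 0 <= k%:R * h by apply: mulr_ge0 => //; exact: ltW.
    by rewrite -nodeE hKE /s0 -natr1; move: h0; clear => ? ? ?; split; lra.
  rewrite nodeE in mF cP cQ.
  have a0 : 0 <= 1 + node K k :> R by move: sl; clear; lra.
  have b0 : 0 <= 1 - node K k :> R by move: su; clear; lra.
  have ba : 0 <= 1 - @node R K k <= 9 * (1 + @node R K k) by rewrite b0 /=; move: sl; clear; lra.
  have ab : 0 <= 1 + @node R K k <= 9 * (1 - @node R K k) by rewrite a0 /=; move: su; clear; lra.
  set a : R := 1 + node K k in mF cP cQ a0 b0 ba ab *; set b : R := 1 - node K k in mF cP cQ a0 b0 ba ab *.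
  pose u : pt R := (s1 * a, s2 * b).
  pose w s := if horizontal s then om * a else om * b.
  have na : `|s1 * a| = a by rewrite normrM n1 mul1r ger0_norm.
  have nb : `|s2 * b| = b by rewrite normrM n2 mul1r ger0_norm.
  have zE s : dot u s.1 = tilt (node K k) (tr s) by rewrite /dot /tilt /= -/a -/b; ring.
  have lamE (x : R) : lam / (1 + 1 / 100) <= x -> om <= 55 / 100 * x.
    have t0 : 0 < 1 + 1 / 100 :> R by clear; lra.
    by rewrite ler_pdivrMr // /om; move: lam0; clear; lra.
  have wP s : s \in P -> w s = om * a by move=> /hP[sH _]; rewrite /w sH.
  have wQ s : s \in Q -> w s = om * b.
    move=> /hQ[/horizontal_swap sH _]; rewrite /w; move: sH.
    by rewrite /swap /=; case: s => [[? ?] [? ?]] /= ->.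
  have core := core_bound (P ++ Q) rest eps u w _ F ncov mF.
  have n1u : nrm1 u = 2 by rewrite nrm1_pair na nb /a /b; clear; lra.
  rewrite n1u in core.
  have {}core : 2 <= eps * 2 - om / 5 * N k + \sum_(s <- Z) `|dot u s.2|.
    have -> : \sum_(s <- Z) `|dot u s.2| = \sum_(s <- P ++ Q) (`|dot u s.2| - w s) +
       (\sum_(s <- P) om * a + \sum_(s <- Q) om * b) + \sum_(s <- rest) `|dot u s.2|.
      rewrite /Z big_cat /=; congr (_ + _); rewrite !big_cat /= !sumrB.
      rewrite [in X in _ - X + _](eq_big_seq _ wP) [in X in _ + (_ - X)](eq_big_seq _ wQ).
      by clear; lra.
    have cst (A : seq (@seg R)) (c : R) : \sum_(s <- A) c = (size A)%:R * c.
      by rewrite big_const_seq count_predT iter_addr_0 [RHS]mulr_natl.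
    rewrite !cst.
    apply: le_trans (core _ _) _; last by clear; lra.
      move=> s; rewrite mem_cat => /orP[sP|sQ].
        have [sH sl'] := hP s sP; rewrite (wP s sP) ger0_norm; last by apply: mulr_ge0 => //; exact: ltW.
        have /andP[_ h20] := sH; apply: le_trans (core_width _ _ _ _ _ n1 n2 a0 ba h20).
        by apply: ler_wpM2r => //; apply: lamE; rewrite -mnorm_horizontal.
      have [sH sl'] := hQ s sQ; rewrite (wQ s sQ) ger0_norm; last by apply: mulr_ge0 => //; exact: ltW.
      have /andP[_ h20] := sH; rewrite (_ : dot u s.2 = dot (s2 * b, s1 * a) (swap s).2); last first.
        by rewrite /dot /= addrC.
      apply: le_trans (core_width _ _ _ _ _ n2 n1 b0 ab h20).
      by apply: ler_wpM2r => //; apply: lamE; rewrite -mnorm_horizontal // mnorm_swap.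
    move=> s; rewrite mem_cat => /orP[sP|sQ].
      by rewrite (wP s sP) zE; apply: cP; apply/mapP; exists s.
    by rewrite (wQ s sQ) zE; apply: cQ; apply/mapP; exists s.
  have plain := width_bound Z eps (s1 * a, - (s2 * b)) ncov.
  rewrite nrm1_pair normrN na nb in plain.
  have e2 : \sum_(s <- Z) `|dot u s.2| + \sum_(s <- Z) `|dot (s1 * a, - (s2 * b)) s.2| = 2 * M k.
    rewrite -big_split /= mulr_sumr; apply: eq_bigr => s _.
    by rewrite normr_dot_reflect na nb.
  by move: core plain; rewrite -e2 (_ : a + b = 2); [clear; lra|rewrite /a /b; clear; lra].
have total : K%:R * 4 + om / 5 * \sum_(k < K) N k <= K%:R * (4 * eps) + 2 * \sum_(k < K) M k.
  have -> : K%:R * 4 = \sum_(k < K) (4 : R) by rewrite sumr_const card_ord mulr_natl.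
  have -> : K%:R * (4 * eps) = \sum_(k < K) (4 * eps) by rewrite sumr_const card_ord mulr_natl.
  by rewrite !mulr_sumr -!big_split /=; apply: ler_sum => k _; apply: step.
have hM : \sum_(k < K) M k <= K%:R * \sum_(s <- Z) nrm s.2.
  by rewrite /M exchange_big /= mulr_sumr; apply: ler_sum => s _; apply: chain_le_nrm.
set SN := \sum_(k < K) N k in hN total; set T := \sum_(s <- Z) nrm s.2 in hM *.
(* [158 / 100] is [2 * (4 / 5 - 1 / 100)]. *)
have gain : (size P)%:R * (size Q)%:R * (158 / 100 * om) <= 262 / 100 * h * SN.
  apply: le_trans hN; apply: ler_wpM2l; first exact: mulr_ge0.
  by move: hom; clear; lra.
have prod : 54 / 100 * (385 / 10000) * (54 / 100 * (113 / 1000)) <=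
    (size P)%:R * om * ((size Q)%:R * om).
  apply: ler_pM; rewrite /om; [clear; lra|clear; lra| |].
    by move: nP; clear; lra.
  by move: nQ; clear; lra.
(* Multiplication by [om * K] turns the numbers of pieces into masses and removes the step size
   through [K * h = 8 / 5]. *)
have gain' : K%:R * (54 / 100 * (385 / 10000) * (54 / 100 * (113 / 1000)) * (158 / 100)) <=
    262 / 100 * (8 / 5) * (om * SN).
  have g1 : om * K%:R * ((size P)%:R * (size Q)%:R * (158 / 100 * om)) <=
     om * K%:R * (262 / 100 * h * SN).
    by apply: ler_wpM2l => //; apply: mulr_ge0; exact: ltW.
  have g2 : om * K%:R * (262 / 100 * h * SN) = 262 / 100 * (8 / 5) * (om * SN).
    by rewrite -hKE; clear; lra.
  have g3 := ler_wpM2l (ltW KK) prod.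
  rewrite -g2; apply: le_trans g1; move: g3; clear; lra.
rewrite -(ler_pM2l KK).
by move: total hM gain' KK; clear; lra.
Qed.

End Final.

(** * Choosing two separated families by pigeonhole *)

Section Pigeonhole.
Context {R : realType}.
Implicit Types (s : @seg R) (Z : seq (@seg R)).

Lemma truncn_count (lam c : R) (k : nat) : 0 < lam -> 0 <= c -> c <= k%:R * lam ->
  exists2 n, (n <= k)%N & c - lam <= n%:R * lam <= c.
Proof.
move=> lam0 c0 h.
have q0 : 0 <= c / lam by apply: divr_ge0 => //; exact: ltW.
have /andP[h1 h2] := truncn_itv q0.
exists (Num.truncn (c / lam)).
  rewrite -(ler_nat R); apply: le_trans h1 _; by rewrite ler_pdivrMr.
rewrite ler_pdivlMr // in h1; rewrite ltr_pdivrMr // -natr1 in h2.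
by rewrite h1 andbT; move: h2; clear; lra.
Qed.

Definition in_column_half (lo : R) (up : bool) s :=
  in_strip lo (1 / 10) s && (if up then 1 / 2 <= s.1.2 else s.1.2 <= 1 / 2).

(* [swap] turns an almost vertical piece of a row into an almost horizontal
   piece of a column. *)
Definition in_row_side (up right : bool) (thr : R) s :=
  in_strip (if up then 0 else 3 / 4) (1 / 4) (swap s) &&
  (if right then thr <= s.1.1 else s.1.1 <= thr).

Lemma in_strip_bounds (a l : R) s : in_strip a l s -> 0 <= a -> a + l <= 1 ->
  [/\ horizontal s, a - 1 / 1000 <= s.1.1, s.1.1 <= a + l + 1 / 1000,
     - (3 / 10) <= s.1.2 & s.1.2 <= 13 / 10].
Proof.
move=> /and3P[h1 /andP[h2 h3] h4] a0 al.
have : `|s.1.2 - 1 / 2| <= 8 / 10.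
  rewrite leNgt; apply/negP => h5; move/negP: h4; apply; rewrite /far_off h5 andbT.
  by move: h2 h3 a0 al; clear => *; apply/andP; split; lra.
by move=> /ler_normlP[n1 n2]; split;
  [exact: h1|exact: h2|exact: h3|move: n1; clear; lra|move: n2; clear; lra].
Qed.

(** The horizontal gap is [275 / 1000] minus the width [1 / 10] of the column, or [175 / 1000],
    minus the tolerance [1 / 1000]; the vertical gap between a half and the opposite quarter is
    [1 / 4] minus the same tolerance. *)
Lemma config_length Z eps (lam lo thr : R) (right up : bool) : near_cover eps Z ->
  {in Z, forall s, mnorm s.2 = 0 \/ lam / (1 + 1 / 100) <= mnorm s.2 <= lam} ->
  0 < lam <= 1 / 2000 -> 0 <= lo <= 9 / 10 ->
  (if right then lo + 275 / 1000 <= thr else thr <= lo - 175 / 1000) ->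
  4 / 100 <= (count (in_column_half lo up) Z)%:R * lam ->
  115 / 1000 <= (count (in_row_side up right thr) Z)%:R * lam ->
  2 + 46 / 10 ^+ 6 <= \sum_(s <- Z) nrm s.2 + 2 * eps.
Proof.
move=> ncov szl /andP[lam0 lam1] /andP[lo0 lo1] hthr hP hQ.
have [n nc /andP[n1 n2]] : exists2 n, (n <= count (in_column_half lo up) Z)%N &
    39 / 1000 - lam <= n%:R * lam <= 39 / 1000.
  by apply: truncn_count; [exact: lam0|clear; lra|move: hP; clear; lra].
have [m mc /andP[m1 m2]] : exists2 n, (n <= count (in_row_side up right thr) Z)%N &
    114 / 1000 - lam <= n%:R * lam <= 114 / 1000.
  by apply: truncn_count; [exact: lam0|clear; lra|move: hQ; clear; lra].
have disj s : in_column_half lo up s -> ~~ in_row_side up right thr s.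
  by move=> /andP[/andP[h _] _]; rewrite /in_row_side /in_strip (horizontal_swap _ h).
have [P [Q [rest [pe sP sQ hPs hQs]]]] := select _ _ _ _ _ _ disj nc mc.
have ncov' := near_cover_perm _ _ _ pe ncov.
have szpos s : s \in Z -> mnorm s.2 != 0 -> lam / (1 + 1 / 100) <= mnorm s.2.
  by move=> /szl[->|/andP[//]]; rewrite eqxx.
have bP s : s \in P -> [/\ horizontal s, lo - 1 / 1000 <= s.1.1, s.1.1 <= lo + 1 / 10 + 1 / 1000,
    - (3 / 10) <= s.1.2 & s.1.2 <= 13 / 10] /\ (if up then 1 / 2 <= s.1.2 else s.1.2 <= 1 / 2).
  move=> /hPs[_ /andP[g hu]]; split; last exact: hu.
  by apply: (in_strip_bounds _ _ _ g lo0); move: lo1; clear; lra.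
pose loy : R := if up then 0 else 3 / 4.
have bQ s : s \in Q -> [/\ horizontal (swap s), loy - 1 / 1000 <= s.1.2, s.1.2 <= loy + 1 / 4 + 1 / 1000,
    - (3 / 10) <= s.1.1 & s.1.1 <= 13 / 10] /\ (if right then thr <= s.1.1 else s.1.1 <= thr).
  move=> /hQs[_ /andP[g hu]]; split; last exact: hu.
  by apply: (in_strip_bounds _ _ _ g); rewrite /loy; clear; case: (up); lra.
rewrite (perm_big _ pe) /=.
pose s1 : R := if right then 1 else - 1; pose s2 : R := if up then 1 else - 1.
apply: (pair_length eps lam P Q rest s1 s2
  (if right then lo - 1 / 1000 else - (lo + 1 / 10 + 1 / 1000))
  (if right then lo + 1 / 10 + 1 / 1000 else - (lo - 1 / 1000))
  (if up then 1 / 2 else - (1 / 2)) (if up then 13 / 10 else 3 / 10)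
  (if right then thr else - thr) (if right then 13 / 10 else 3 / 10)
  (if up then - (1 / 1000) else - (1 + 1 / 1000))
  (if up then 1 / 4 + 1 / 1000 else - (3 / 4 - 1 / 1000)) ncov').
- by rewrite /s1; case: (right); rewrite ?normrN normr1.
- by rewrite /s2; case: (up); rewrite ?normrN normr1.
- by rewrite lam0; move: lam1; clear; lra.
- move=> s sin; have [[sH _ _ _ _] _] := bP s sin; split; first exact: sH.
  apply: szpos; first by case: (hPs s sin).
  by rewrite mnorm_horizontal // normr_eq0; case/andP: sH.
- move=> s sin; have [[sH _ _ _ _] _] := bQ s sin; split; first exact: sH.
  apply: szpos; first by case: (hQs s sin).
  by rewrite -mnorm_swap mnorm_horizontal // normr_eq0; case/andP: sH.
- move=> s /bP[[_ h1 h2 h3 h4] h5]; rewrite /s1 /s2; move: h1 h2 h3 h4 h5; clear => h1 h2 h3 h4.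
  by case: (right); case: (up) => h5; split; apply/andP; split; lra.
- move=> s /bQ[[_ h1 h2 h3 h4] h5]; rewrite /s1 /s2; move: h1 h2 h3 h4 h5; rewrite /loy; clear.
  by case: (right); case: (up) => h1 h2 h3 h4 h5; split; apply/andP; split; lra.
- by move: hthr; case: (right); clear; lra.
- by move: lo0 lo1; case: (right); clear; lra.
- by case: (up); clear; lra.
- by case: (up); clear; lra.
- by rewrite sP; move: n1 n2 lam1; clear => *; apply/andP; split; lra.
- by rewrite sQ; move: m1 m2 lam1; clear => *; apply/andP; split; lra.
Qed.

Lemma count_half (lam c : R) (Z : seq (@seg R)) (a b d : pred (@seg R)) : 0 < lam ->
  (forall s, a s -> b s \/ d s) -> 2 * c <= (count a Z)%:R * lam ->
  c <= (count b Z)%:R * lam \/ c <= (count d Z)%:R * lam.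
Proof.
move=> lam0 abd h.
have [|lt] := leP c ((count b Z)%:R * lam); [by left|right].
have : (count a Z <= count b Z + count d Z)%N.
  rewrite -count_predUI; apply: leq_trans (leq_addr _ _); apply: sub_count => s /abd[]/= ->//.
  by rewrite orbT.
rewrite -(ler_nat R) natrD => h'.
have := ler_wpM2r (ltW lam0) h'.
by move: lt h; clear; lra.
Qed.

(** Three columns start at 0, [45 / 100] and [9 / 10]. Two of them have a heavy half on the same
    side, upper or lower, and of these two at least one is clear of half of the almost vertical mass
    in the opposite row. *)
Lemma segments_length Z eps lam : near_cover eps Z -> 0 <= eps <= 1 / 10 ^+ 6 ->
  {in Z, forall s, mnorm s.2 = 0 \/ lam / (1 + 1 / 100) <= mnorm s.2 <= lam} ->
  0 < lam <= 1 / 2000 ->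
  2 + 2 / 10 ^+ 5 < \sum_(s <- Z) nrm s.2.
Proof.
move=> ncov he szl hl; have /andP[lam0 lam1] := hl; have /andP[eps0 eps1] := he.
rewrite ltNge; apply/negP => T.
(* The gain exceeds the assumed excess [20 / 10 ^+ 6] and [2 * eps] together. *)
suff : 2 + 46 / 10 ^+ 6 <= \sum_(s <- Z) nrm s.2 + 2 * eps by move: T eps1; clear; lra.
have szle : {in Z, forall s, mnorm s.2 <= lam}.
  by move=> s /szl[->|/andP[//]]; exact: ltW.
have lam1' : lam <= 1 / 1000 by move: lam1; clear; lra.
(* The mass [1 / 10 - 2 / 100] of a column is split at mid-height; the mass [1 / 4 - 2 / 100] of a
   row is split next, by an arbitrary pair of conditions that covers all cases. *)
have rows (lo : R) : 0 <= lo <= 9 / 10 -> exists up, 4 / 100 <= (count (in_column_half lo up) Z)%:R * lam.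
  move=> /andP[l0 l1].
  have h : 1 / 10 - 2 / 100 <= (count (in_strip lo (1 / 10)) Z)%:R * lam.
    by apply: (strip_mass _ _ _ _ _ ncov he szle lam1' T l0); move: l1; clear; lra.
  have [||g|g] := count_half lam (4 / 100) Z (in_strip lo (1 / 10))
    (in_column_half lo true) (in_column_half lo false) lam0.
  - move=> s g; rewrite /in_column_half g /=; case: (leP (1 / 2) s.1.2); [by left|right; exact: ltW].
  - by move: h; clear; lra.
  - by exists true.
  - by exists false.
have cols up : forall b d, (forall s, b s || d s) ->
    let f c := 115 / 1000 <= (count (fun s =>
      in_strip (if up then 0 else 3 / 4) (1 / 4) (swap s) && c s) Z)%:R * lam in
    f b \/ f d.
  move=> b d bd f.
  apply: (count_half _ _ _ (fun s => in_strip (if up then 0 else 3 / 4) (1 / 4) (swap s)) _ _ lam0).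
    by move=> s g; rewrite g /=; apply/orP.
  have : 1 / 4 - 2 / 100 <= (count (fun s =>
      in_strip (if up then 0 else 3 / 4) (1 / 4) (swap s)) Z)%:R * lam.
    by apply: (strip_mass_swap _ _ _ _ _ ncov he szle lam1' T); clear; case: (up); lra.
  by clear; lra.
pose good up lo := exists right thr, (if right then lo + 275 / 1000 <= thr else thr <= lo - 175 / 1000) /\
  115 / 1000 <= (count (in_row_side up right thr) Z)%:R * lam.
have fin lo up : 0 <= lo <= 9 / 10 -> 4 / 100 <= (count (in_column_half lo up) Z)%:R * lam -> good up lo ->
    2 + 46 / 10 ^+ 6 <= \sum_(s <- Z) nrm s.2 + 2 * eps.
  by move=> hlo hr [right [thr [ht hc]]]; apply: config_length ht hr hc.
(* [t1] keeps the required distance from the columns at 0 and [45 / 100], and [t2] from those at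
   [45 / 100] and [9 / 10]. *)
pose t1 : R := 275 / 1000; pose t2 : R := 725 / 1000.
have g1 up : 115 / 1000 <= (count (in_row_side up true t1) Z)%:R * lam -> good up 0.
  by move=> h; exists true, t1; split; [|exact: h]; rewrite /t1; clear; lra.
have g2 up : 115 / 1000 <= (count (in_row_side up false t1) Z)%:R * lam -> good up (45 / 100).
  by move=> h; exists false, t1; split; [|exact: h]; rewrite /t1; clear; lra.
have g2' up : 115 / 1000 <= (count (in_row_side up true t2) Z)%:R * lam -> good up (45 / 100).
  by move=> h; exists true, t2; split; [|exact: h]; rewrite /t2; clear; lra.
have g3 up : 115 / 1000 <= (count (in_row_side up false t2) Z)%:R * lam -> good up (9 / 10).
  by move=> h; exists false, t2; split; [|exact: h]; rewrite /t2; clear; lra.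
have c12 up : good up 0 \/ good up (45 / 100).
  have [s||] := cols up (fun s => t1 <= s.1.1) (fun s => s.1.1 <= t1); first exact: le_total.
    by move/g1; left.
  by move/g2; right.
have c23 up : good up (45 / 100) \/ good up (9 / 10).
  have [s||] := cols up (fun s => t2 <= s.1.1) (fun s => s.1.1 <= t2); first exact: le_total.
    by move/g2'; left.
  by move/g3; right.
(* Since [t1 < t2], every piece lies to the right of [t1] or to the left of [t2]. *)
have c13 up : good up 0 \/ good up (9 / 10).
  have [s||] := cols up (fun s => t1 <= s.1.1) (fun s => s.1.1 <= t2).
  - by case: (leP t1 s.1.1) => //= h; move: h; rewrite /t1 /t2; clear; lra.
  - by move/g1; left.
  - by move/g3; right.
have b1 : 0 <= (0 : R) <= 9 / 10 by clear; lra.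
have b2 : 0 <= (45 / 100 : R) <= 9 / 10 by clear; lra.
have b3 : 0 <= (9 / 10 : R) <= 9 / 10 by clear; lra.
have [u1 r1] := rows _ b1; have [u2 r2] := rows _ b2; have [u3 r3] := rows _ b3.
have f1 := fin _ _ b1 r1; have f2 := fin _ _ b2 r2; have f3 := fin _ _ b3 r3.
(* Two of the three booleans agree, and of any two columns one is [good] for the common value. *)
have [e|n12] := eqVneq u1 u2.
  by rewrite -e in f2; case: (c12 u1) => [/f1|/f2].
have [e|n23] := eqVneq u2 u3.
  by rewrite -e in f3; case: (c23 u2) => [/f2|/f3].
have e : u1 = u3 by move: n12 n23; case: (u1); case: (u2); case: (u3).
by rewrite -e in f3; case: (c13 u1) => [/f1|/f3].
Qed.

End Pigeonhole.

Theorem theorem1 (R : realType) (B : set (pt R)) (L : \bar R) :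
  barrier (@unit_square R) B -> rectifiable_with_length B L ->
  (((2 + 2 / 10 ^+ 5 : R))%:E <= L)%E.
Proof.
case: L => [l bar rect|_ _|_ [S [g [_ [_ [_ [_ [lE _]]]]]]]]; last 1 first.
(* The case of length [-oo] contradicts that lengths are non-negative. *)
- have : (0 <= \sum_(i <oo | i \in S) curve_length (g i))%E.
    by apply: nneseries_ge0 => i _ _; exact: curve_length_ge0.
  by rewrite -lE.
- have eps0 : 0 < 1 / 10 ^+ 6 :> R by rewrite divr_gt0 // exprn_gt0.
  have [Z lZ ncov] := barrier_segments _ _ _ bar rect eps0.
  have [||Z' [lam [hl ncov' sumE szZ]]] := subdivide Z _ (1 / 2000) (1 / 100) ncov.
  + by lra.
  + by lra.
  have := segments_length Z' _ lam ncov' _ szZ hl.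
  rewrite (ltW eps0) lexx sumE lee_fin => /(_ isT) /ltW h.
  exact: le_trans lZ.
- exact: leey.
Qed.
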